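(* Let $Q$ be a source-sink orientation of the $(n+1)$-cycle, with unique source $s$ and unique sink $t$. Then: (1) every coordinate difference satisfies $|c_v-c_w|\le 1$ for all $c\in C(Q)$, so the band of each pair of distinct vertices $v,w$ is $\{(x,y)\in\mathbb{Z}^2:|x-y|\le 1\}$; (2) for every pair $(v,w)$ of distinct vertices with $\{v,w\}\neq\{s,t\}$, the projection $\pi_{vw}$ maps $C(Q)$ onto the full band $\{(x,y)\in\mathbb{Z}^2:|x-y|\le1\}$; (3) for the source-sink pair, $\pi_{st}(C(Q))$ is the band $\{(x,y)\in\mathbb{Z}^2:|x-y|\le1\}$ with the diagonal $\{x=y\}$ removed except for a bounded segment of it; the diagonal $\{c_s=c_t\}$ carries only the regular part of $C(Q)$. In particular, the source-sink diagonal $\{c_s=c_t\}$ is the unique non-filled band line (among all band lines of all pairs).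
   Context: All quivers are finite, connected, and without loops or 2-cycles. $C(Q)\subset\mathbb{Z}^{Q_0}$ denotes the set of all $c$-vectors of the cluster algebra with principal coefficients at the seed associated with the acyclic quiver $Q$; it is known that $C(Q)=\{\pm\beta:\beta\text{ a real Schur root of }Q\}$, the real Schur roots being the dimension vectors of the exceptional (rigid, indecomposable) $kQ$-modules, $k$ algebraically closed. A source-sink orientation of the $(n+1)$-cycle is an acyclic orientation having a unique source $s$ and a unique sink $t$; these divide the cycle into two oriented paths from $s$ to $t$ of lengths $p$ and $q$ with $p+q=n+1$ (affine type $\widetilde A_n$, null root $\delta=(1,\dots,1)$). For vertices $v,w$, $\pi_{vw}:\mathbb{Z}^{Q_0}\to\mathbb{Z}^2$ is $\pi_{vw}(c)=(c_v,c_w)$. With $b_{vw}=\sup_{c\in C(Q)}|c_v-c_w|<\infty$, the band of $(v,w)$ is $\{(x,y)\in\mathbb{Z}^2:|x-y|\le b_{vw}\}$; its band lines are $\{c_v-c_w=d\}$ for integers $|d|\le b_{vw}$, and such a line is filled if $\pi_{vw}(C(Q))$ contains every integer point of it. The regular part of $C(Q)$ consists of the vectors $\pm\underline{\dim}\,M$ with $M$ an exceptional regular $kQ$-module (an indecomposable that is neither preprojective nor preinjective); equivalently, of the $c\in C(Q)$ with $\partial(c)=0$, where $\partial(x)=\langle\delta,x\rangle$ is the defect and $\langle x,y\rangle=\sum_i x_iy_i-\sum_{i\to j}x_iy_j$ is the Euler form. *)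

(* Defs.v *)
From mathcomp Require Import all_boot all_order all_algebra.
From mathcomp Require Import classical_sets.

Set Implicit Arguments.
Unset Strict Implicit.
Unset Printing Implicit Defensive.

Import Order.TTheory GRing.Theory Num.Theory.
Local Open Scope classical_set_scope.
Local Open Scope ring_scope.

(* A finite quiver on the vertices 'I_m, given by its arrow multiplicities:
   Q i j is the number of arrows i -> j. *)
Definition quiver (m : nat) := 'M[nat]_m.

Definition arrow m (Q : quiver m) : rel 'I_m := fun i j => (0 < Q i j)%N.

Definition acyclic_quiver m (Q : quiver m) : Prop :=
  forall c : seq 'I_m, cycle (arrow Q) c -> c = [::].

Definition is_source m (Q : quiver m) (v : 'I_m) : Prop :=
  forall i, ~~ arrow Q i v.

Definition is_sink m (Q : quiver m) (v : 'I_m) : Prop :=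
  forall i, ~~ arrow Q v i.

Definition exchange_matrix m (Q : quiver m) : 'M[int]_m :=
  \matrix_(i, j) ((Q i j)%:Z - (Q j i)%:Z).

Definition pos_part (x : int) : int := Num.max x 0.

(* Fomin-Zelevinsky mutation, in direction k, of an extended exchange matrix:
   the upper square block is the exchange matrix, the lower one carries the
   coefficients. *)
Definition mutate m (k : 'I_m) (M : 'M[int]_(m + m, m)) : 'M[int]_(m + m, m) :=
  \matrix_(i, j)
    if (i == lshift m k) || (j == k) then - M i j
    else M i j + pos_part (M i k) * pos_part (M (lshift m k) j)
               - pos_part (- M i k) * pos_part (- M (lshift m k) j).

Definition principal_matrix m (Q : quiver m) : 'M[int]_(m + m, m) :=
  col_mx (exchange_matrix Q) 1%:M.

(* The extended exchange matrix of the seed obtained from the principal seed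
   by mutating successively in the directions listed in ks. *)
Definition mutated_matrix m (Q : quiver m) (ks : seq 'I_m) :=
  foldl (fun M k => mutate k M) (principal_matrix Q) ks.

(* C(Q): the columns of the coefficient blocks of all seeds. *)
Definition c_vectors m (Q : quiver m) : set 'cV[int]_m :=
  [set c | exists ks : seq 'I_m, exists j : 'I_m,
             c = col j (dsubmx (mutated_matrix Q ks))].

(* The quiver obtained from the cycle with edges {k, k + 1 mod n+1} by
   orienting the k-th edge as k -> k+1 when o k holds and as k+1 -> k
   otherwise. For n = 1 the two edges join the same two vertices. *)
Definition cycle_quiver n (o : 'I_n.+1 -> bool) : quiver n.+1 :=
  \matrix_(i, j) #|[set k : 'I_n.+1 |
     if o k then (i == k) && (j == ordS k) else (i == ordS k) && (j == k)]%SET|.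

Definition source_sink_orientation n (o : 'I_n.+1 -> bool) (s t : 'I_n.+1)
    : Prop :=
  [/\ acyclic_quiver (cycle_quiver o),
      forall v, is_source (cycle_quiver o) v <-> v = s
    & forall v, is_sink (cycle_quiver o) v <-> v = t].

Definition euler_form m (Q : quiver m) (x y : 'cV[int]_m) : int :=
  \sum_i x i 0 * y i 0 - \sum_i \sum_j (Q i j)%:Z * (x i 0 * y j 0).

Definition null_root m : 'cV[int]_m := const_mx 1.

Definition defect m (Q : quiver m) (x : 'cV[int]_m) : int :=
  euler_form Q (null_root m) x.

(* In affine type: the c-vectors +-dim M with M exceptional regular are those
   of defect zero. *)
Definition regular_part m (Q : quiver m) : set 'cV[int]_m :=
  [set c | c_vectors Q c /\ defect Q c = 0].

Definition coord_proj m (v w : 'I_m) (c : 'cV[int]_m) : int * int :=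
  (c v 0, c w 0).

(* The supremum of the |c_v - c_w|; it would be the default value 0, were
   these unbounded. *)
Definition band_width m (Q : quiver m) (v w : 'I_m) : int :=
  supremum 0 [set `|c v 0 - c w 0| | c in c_vectors Q].

Definition band m (Q : quiver m) (v w : 'I_m) : set (int * int) :=
  [set xy | `|xy.1 - xy.2| <= band_width Q v w].

Definition unit_band : set (int * int) := [set xy | `|xy.1 - xy.2| <= 1].

Definition line (d : int) : set (int * int) := [set xy | xy.1 - xy.2 = d].

Definition is_band_line m (Q : quiver m) (v w : 'I_m) (d : int) : Prop :=
  `|d| <= band_width Q v w.

Definition filled m (Q : quiver m) (v w : 'I_m) (d : int) : Prop :=
  line d `<=` coord_proj v w @` c_vectors Q.

Definition same_pair (T : Type) (v w s t : T) : Prop :=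
  (v = s /\ w = t) \/ (v = t /\ w = s).

(* Main.v *)
(** The universal cover of the cycle has the integers as edges; place the edge
    [a] at the point [a] on the upper or on the lower side of a strip, according
    to its orientation. A pair [(a, b)] of points encodes, up to sign, the sum of
    the simple roots of the vertices between the edges [a] and [b]. A seed is
    then a periodic family of pairwise noncrossing directed arcs of the strip, a
    c-vector being positive when its arc points to the right, and a mutation
    slides ends of arcs along the translates of the mutated arc. The coordinates
    of the encoded vectors differ by at most 1, and [c_s - c_t], which is the
    defect, vanishes exactly when both ends of the arc lie on the same side;
    such an arc does not cross its own translates, so it is shorter than the
    cycle.

    Conversely, as long as the arcs of a seed form a path through all the
    points, a mutation at an arc from the lower to the upper side exchanges two
    neighbours of the path, as in an exclusion process. A lower point has to
    meet every upper point to its right, so that all these pairs occur.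
    Mutating once at each vertex, sinks first, yields the opposite of the
    principal seed of the opposite quiver, which supplies the pairs from the
    upper to the lower side. *)

Require Import Defs.
From mathcomp Require Import all_boot all_order all_algebra.
From mathcomp Require Import boolp classical_sets.
From mathcomp Require Import zify ring.

Set Implicit Arguments.
Unset Strict Implicit.
Unset Printing Implicit Defensive.

Import Order.TTheory GRing.Theory Num.Theory.
Local Open Scope classical_set_scope.
Local Open Scope ring_scope.

(** * Arcs in a strip *)

Section CircleOrder.
Variables (T : eqType) (lt : rel T) (u : T -> bool).
Implicit Types (a b c d p q v : T) (x y z : T * T).

(* The points lie on the boundary of a strip, those with [u] on the upper
   side and the others on the lower side, both placed by their value. The
   boundary is read counterclockwise: the lower side increasing, then the
   upper side decreasing. *)
Definition circle_lt a b := if u a then u b && lt b a else u b || lt a b.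

Definition ccw a b c :=
  [|| circle_lt a b && circle_lt b c, circle_lt b c && circle_lt c a
    | circle_lt c a && circle_lt a b].

Definition positive x := lt x.1 x.2.

Definition crossing x y :=
  (ccw x.1 y.1 x.2 && ccw x.1 x.2 y.2) || (ccw x.1 y.2 x.2 && ccw x.1 x.2 y.1).

Definition parallel x y :=
  ((x.1 == y.1) && (x.2 == y.2)) || ((x.1 == y.2) && (x.2 == y.1)).

(* Here [x] joins [v] to [p], and [y] joins [v] to [q]. *)
Definition positive_first x y v p q :=
  (positive x == positive y) || (if positive x then ccw v p q else ccw v q p).

(* In addition to being noncrossing, two edges meeting at a point have the
   positive one first if their signs differ; if they agree, one edge enters and
   the other leaves the point. *)
Definition compatible x y :=
  [&& ~~ crossing x y, ~~ parallel x y,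
   (x.1 == y.1) ==>
     (positive x != positive y) && positive_first x y x.1 x.2 y.2,
   (x.2 == y.2) ==>
     (positive x != positive y) && positive_first x y x.2 x.1 y.1,
   (x.1 == y.2) ==> positive_first x y x.1 x.2 y.1 &
   (x.2 == y.1) ==> positive_first x y x.2 x.1 y.2].

(* What the sliding of the tail of an edge along a positive edge [z] needs to
   know about the position of [y] relative to [z]; it holds before both of the
   half-slides that make up a mutation. *)
Definition slidable y z :=
  [&& ~~ crossing y z, ~~ parallel y z,
   (y.1 == z.2) ==> (positive y || ccw z.2 z.1 y.2),
   (y.1 == z.1) ==> (~~ positive y && ccw z.1 z.2 y.2),
   (y.2 == z.2) ==> (ccw z.2 y.1 z.1 || (~~ positive y && ccw z.2 z.1 y.1)) &
   (y.2 == z.1) ==> (positive y || ccw z.1 z.2 y.1)].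

(* The position of [y] relative to the positive edge [z] once the tails at the
   head of [z] have slid to the tail of [z]. *)
Definition tails_slid y z :=
  [&& ~~ crossing y z, ~~ parallel y z,
   (y.1 == z.2) ==> (positive y && ccw z.2 y.2 z.1),
   (y.1 == z.1) ==> (ccw z.1 y.2 z.2 || (~~ positive y && ccw z.1 z.2 y.2)),
   (y.2 == z.2) ==> (~~ positive y && ccw z.2 z.1 y.1) &
   (y.2 == z.1) ==> (positive y || ccw z.1 z.2 y.1)].

(* The same condition after a rotation of the strip by a half-turn. *)
Definition heads_slid y z :=
  [&& ~~ crossing y z, ~~ parallel y z,
   (y.2 == z.1) ==> (positive y && ccw z.1 y.1 z.2),
   (y.2 == z.2) ==> (ccw z.2 y.1 z.1 || (~~ positive y && ccw z.2 z.1 y.1)),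
   (y.1 == z.1) ==> (~~ positive y && ccw z.1 z.2 y.2) &
   (y.1 == z.2) ==> (positive y || ccw z.2 z.1 y.2)].

Definition same_direction p q c d :=
  [&& lt c d, c != q, d != p, u c == u p, u d == u q & lt c p == lt d q].

(** These conditions on the first three points guard the enumeration below: the last two points
    range freely only where the guard holds. Setting [b] equal to [p] leaves only four points to
    enumerate. *)
Definition slid_slidable p q b := [&& lt p q, ccw q p b & slidable (q, b) (p, q)].
Definition slid_compatible p q b :=
  [&& lt p q, ccw q p b & compatible (q, b) (p, q)].
Definition slid_heads p q b := [&& lt p q, ccw q p b & heads_slid (q, b) (p, q)].
Definition four_points p q b := b == p.
Definition four_points_lt p q b := lt p q && (b == p).
Definition consecutive p q b := [&& lt p b, lt b q, u p == u b & u q == u b].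

Definition compatible_sym_formula p q (b : T) c d :=
  compatible (p, q) (c, d) ==> compatible (c, d) (p, q).
Definition slide_one_formula p q b c d :=
  [==> compatible (q, b) (c, d), slidable (c, d) (p, q),
       ~~ ((c == q) && ccw q p d) => compatible (p, b) (c, d)].
Definition slide_both_formula p q b c d :=
  [==> c == q, compatible (q, b) (c, d), slidable (c, d) (p, q), ccw q p d
   => compatible (p, b) (p, d)].
Definition slide_slidable_formula p q b c d :=
  [==> same_direction p q c d, compatible (p, q) (c, d), slidable (q, b) (c, d)
   => slidable (p, b) (c, d)].
Definition slide_tails_formula p q b c d :=
  tails_slid (p, b) (p, q) &&
  [==> same_direction p q c d, compatible (p, q) (c, d),
       compatible (q, b) (c, d) => tails_slid (p, b) (c, d)].
Definition unslid_tails_formula p q (b : T) c d :=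
  [==> compatible (c, d) (p, q), ~~ ((c == q) && ccw q p d)
   => tails_slid (c, d) (p, q)].
Definition slide_heads_formula p q b c d :=
  compatible (p, b) (q, p) &&
  [==> same_direction p q c d, compatible (p, q) (c, d),
       heads_slid (q, b) (c, d) => compatible (p, b) (d, c)].
Definition unslid_heads_formula p q (b : T) c d :=
  [==> heads_slid (c, d) (p, q), ~~ ((c == q) && ccw q p d)
   => compatible (c, d) (q, p)].
Definition slidable_formula p q (b : T) c d :=
  (compatible (c, d) (p, q) || heads_slid (c, d) (p, q))
    ==> slidable (c, d) (p, q).
(* With [(c, d)] a translate of [(p, q)]: the edge [(q, c)] slides at both of its
   ends or at neither. *)
Definition kronecker_formula p q (b : T) c d :=
  [==> same_direction p q c d, u p != u q, compatible (p, q) (c, d),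
       compatible (q, c) (p, q), compatible (q, c) (c, d)
   => if ccw q p c then ccw c d p && ccw c d q else ~~ ccw c d q].
(** With [b] strictly between [p] and [q] on one side, an arc from [b] to the other side crosses an
    arc joining [p] and [q]. If instead [(p, b)] and [(b, q)] are arcs, it would have to be
    negative, yet it separates these two positive arcs around [b], and positive arcs come first. *)
Definition covered_formula p q b c (d : T) :=
  (u c != u b) ==>
    ~~ [|| compatible (b, c) (p, q), compatible (c, b) (p, q),
           compatible (b, c) (p, b) && compatible (b, c) (b, q)
         | compatible (c, b) (p, b) && compatible (c, b) (b, q)].

Definition separated_formula p q (b : T) c d :=
  [==> lt c d, (q == c) || lt q c => compatible (p, q) (c, d)].

(* [local_form] is the contribution of one pair of lifts to [omega] below. *)
Definition sign_at a b : int :=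
  if u a == u b then if a == b then 0 else if lt a b == u a then 1 else -1 else 0.
Definition local_form x y : int :=
  sign_at x.2 y.2 - sign_at x.2 y.1 - sign_at x.1 y.2 + sign_at x.1 y.1.
(** For compatible arcs only common ends contribute: a head meeting a tail counts 1 or -1 according
    to the side, a common tail or head counts -1. *)
Definition local_form_formula p q (b : T) c d :=
  compatible (c, d) (p, q) ==>
  (local_form (p, q) (c, d) ==
     (if c == q then if ccw q p d then 1 else -1 else 0) +
     (if d == p then if ccw p q c then 1 else -1 else 0) -
     (c == p)%:Z - (d == q)%:Z).

End CircleOrder.

(* A statement about at most five points depends only on their labels and on
   their relative order, hence it can be checked on the points 0, ..., 4. *)
Fixpoint all_labels k (P : seq bool -> bool) :=
  if k is k'.+1 then
    all_labels k' (fun l => P (true :: l)) && all_labels k' (fun l => P (false :: l))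
  else P [::].

Lemma all_labelsP k P l : all_labels k P -> size l = k -> P l.
Proof.
elim: k P l => [|k IHk] P [] //= b l /andP[Pt Pf] [szl].
by case: b; [exact: (IHk _ _ Pt) | exact: (IHk _ _ Pf)].
Qed.

Section OrderTypes.
Variables (H : (nat -> bool) -> nat -> nat -> nat -> bool).
Variables (F : (nat -> bool) -> nat -> nat -> nat -> nat -> nat -> bool).

Definition check_order_types :=
  let r := iota 0 5 in
  all_labels 5 (fun l => let u := nth false l in
    all (fun p => all (fun q => all (fun b =>
      if H u p q b then all (fun c => all (F u p q b c) r) r else true) r) r) r).

Lemma check_order_typesP l (p q b c d : nat) :
  check_order_types -> size l = 5 ->
  (p < 5)%N -> (q < 5)%N -> (b < 5)%N -> (c < 5)%N -> (d < 5)%N ->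
  H (nth false l) p q b -> F (nth false l) p q b c d.
Proof.
move=> chk szl p5 q5 b5 c5 d5 Hb.
have r5 k : (k < 5)%N -> k \in iota 0 5 by rewrite mem_iota.
have /allP/(_ p (r5 p p5)) := all_labelsP chk szl.
move=> /allP/(_ q (r5 q q5))/allP/(_ b (r5 b b5)); rewrite Hb.
by move=> /allP/(_ c (r5 c c5))/allP/(_ d (r5 d d5)).
Qed.
End OrderTypes.

(** Sorting the distinct values among the five points gives an order embedding [f] of at most five
    indices, along which the labels are carried; a check on 0, ..., 4 thus transfers to arbitrary
    integers. *)
Lemma order_typesP (u : int -> bool) (p q b c d : int) :
  exists m (f : 'I_m -> int) (l : seq bool) (i j k h g : 'I_m),
  [/\ [/\ p = f i, q = f j, b = f k, c = f h & d = f g],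
      {mono f : x y / (x < y)%N >-> x < y},
      forall x y, (f x == f y) = (val x == val y),
      forall x, u (f x) = nth false l x &
      forall H F, check_order_types H F ->
        H (nth false l) i j k -> F (nth false l) i j k h g].
Proof.
pose s := [:: p; q; b; c; d]; pose t := sort <=%O (undup s).
have tlt : sorted <%O t by rewrite sort_lt_sorted undup_uniq.
have lt5 (x : 'I_(size t)) : (x < 5)%N.
  by rewrite (leq_trans (ltn_ord x)) // size_sort size_undup.
pose f (x : 'I_(size t)) := t`_x.
have fE x : x \in s -> exists y, x = f y.
  move=> xs; have xt : x \in t by rewrite mem_sort mem_undup.
  have it : (index x t < size t)%N by rewrite index_mem.
  by exists (Ordinal it); rewrite /f /= nth_index.
have [i pE] := fE p (mem_head _ _).
have [j qE] : exists y, q = f y by apply: fE; rewrite !inE eqxx orbT.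
have [k bE] : exists y, b = f y by apply: fE; rewrite !inE eqxx !orbT.
have [h cE] : exists y, c = f y by apply: fE; rewrite !inE eqxx !orbT.
have [g dE] : exists y, d = f y by apply: fE; rewrite !inE eqxx !orbT.
(* The label list has length 5 in all cases; its entries from [size t] on are padding. *)
exists (size t), f, (mkseq (fun n => u t`_n) 5), i, j, k, h, g; split=> //.
- by move=> x y; rewrite (lt_sorted_ltn_nth 0) ?inE.
- by move=> x y; rewrite nth_uniq ?(lt_sorted_uniq tlt).
- by move=> x; rewrite nth_mkseq.
- by move=> H F chk Hk; apply: (check_order_typesP chk); rewrite ?size_mkseq.
Qed.

Ltac order_types p q b c d H F :=
  let u := match goal with u : int -> bool |- _ => u end in
  let chk := fresh "chk" in
  (have chk : check_order_types H F by lazy);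
  let flt := fresh "flt" in let feq := fresh "feq" in let lE := fresh "lE" in
  have [? [? [? [? [? [? [? [? [[-> -> -> -> ->] flt feq lE]]]]]]]]] :=
    order_typesP u p q b c d;
  move=> /(_ _ _ chk);
  rewrite /slid_slidable /slid_compatible /slid_heads /four_points
   /four_points_lt /consecutive /compatible_sym_formula /slide_one_formula
   /slide_both_formula /slide_slidable_formula /slide_tails_formula
   /unslid_tails_formula /slide_heads_formula /unslid_heads_formula
   /slidable_formula /kronecker_formula /covered_formula
   /separated_formula /local_form_formula /local_form /sign_at
   /same_direction /compatible /slidable /tails_slid /heads_slid /positive_first
   /crossing /parallel /positive /ccw /circle_lt /= !flt !feq !lE; exact.

(** * The finite checks, transferred to integer points *)

Section IntegerPoints.
Variable u : int -> bool.
Implicit Types p q b c d : int.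

Lemma compatible_symP p q b c d :
  four_points p q b -> compatible_sym_formula <%O u p q b c d.
Proof. order_types p q b c d (fun _ : nat -> bool => @four_points nat)
  (@compatible_sym_formula nat ltn). Qed.

Lemma slide_oneP p q b c d :
  slid_slidable <%O u p q b -> slide_one_formula <%O u p q b c d.
Proof. order_types p q b c d (@slid_slidable nat ltn)
  (@slide_one_formula nat ltn). Qed.

Lemma slide_bothP p q b c d :
  slid_slidable <%O u p q b -> slide_both_formula <%O u p q b c d.
Proof. order_types p q b c d (@slid_slidable nat ltn)
  (@slide_both_formula nat ltn). Qed.

Lemma slide_slidableP p q b c d :
  slid_slidable <%O u p q b -> slide_slidable_formula <%O u p q b c d.
Proof. order_types p q b c d (@slid_slidable nat ltn)
  (@slide_slidable_formula nat ltn). Qed.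

Lemma slide_tailsP p q b c d :
  slid_compatible <%O u p q b -> slide_tails_formula <%O u p q b c d.
Proof. order_types p q b c d (@slid_compatible nat ltn)
  (@slide_tails_formula nat ltn). Qed.

Lemma unslid_tailsP p q b c d :
  four_points_lt <%O p q b -> unslid_tails_formula <%O u p q b c d.
Proof. order_types p q b c d (fun _ : nat -> bool => four_points_lt ltn)
  (@unslid_tails_formula nat ltn). Qed.

Lemma slide_headsP p q b c d :
  slid_heads <%O u p q b -> slide_heads_formula <%O u p q b c d.
Proof. order_types p q b c d (@slid_heads nat ltn)
  (@slide_heads_formula nat ltn). Qed.

Lemma unslid_headsP p q b c d :
  four_points_lt <%O p q b -> unslid_heads_formula <%O u p q b c d.
Proof. order_types p q b c d (fun _ : nat -> bool => four_points_lt ltn)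
  (@unslid_heads_formula nat ltn). Qed.

Lemma slidableP p q b c d :
  four_points_lt <%O p q b -> slidable_formula <%O u p q b c d.
Proof. order_types p q b c d (fun _ : nat -> bool => four_points_lt ltn)
  (@slidable_formula nat ltn). Qed.

Lemma kroneckerP p q b c d :
  four_points_lt <%O p q b -> kronecker_formula <%O u p q b c d.
Proof. order_types p q b c d (fun _ : nat -> bool => four_points_lt ltn)
  (@kronecker_formula nat ltn). Qed.

Lemma coveredP p q b c d :
  consecutive <%O u p q b -> covered_formula <%O u p q b c d.
Proof. order_types p q b c d (@consecutive nat ltn)
  (@covered_formula nat ltn). Qed.

Lemma local_formP p q b c d :
  four_points_lt <%O p q b -> local_form_formula <%O u p q b c d.
Proof. order_types p q b c d (fun _ : nat -> bool => four_points_lt ltn)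
  (@local_form_formula nat ltn). Qed.

Lemma separatedP p q b c d :
  four_points_lt <%O p q b -> separated_formula <%O u p q b c d.
Proof. order_types p q b c d (fun _ : nat -> bool => four_points_lt ltn)
  (@separated_formula nat ltn). Qed.

End IntegerPoints.

(** * Symmetries of the strip *)

Notation edge := (int * int)%type.
Implicit Types (x y z : int * int) (u : int -> bool).

Definition rev_edge x : edge := (x.2, x.1).
(** The half-turn of the strip exchanges its sides and sends [a] to [- a]; exchanging the ends as
    well keeps positive arcs positive. Heads become tails, so head slides are reduced to tail
    slides. *)
Definition rot_edge x : edge := (- x.2, - x.1).
Definition rot_label u (a : int) := ~~ u (- a).

Lemma compatibleC u x y : compatible <%O u x y = compatible <%O u y x.
Proof.
case: x y => [a b] [c d]; apply/idP/idP.
  by have := @compatible_symP u a b a c d (eqxx _); move/implyP; apply.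
by have := @compatible_symP u c d c a b (eqxx _); move/implyP; apply.
Qed.

Lemma ccwC u a b c : ccw <%O u a b c = ccw <%O u b c a.
Proof. by rewrite /ccw orbC -orbA. Qed.

Lemma ccwC2 u a b c : ccw <%O u a b c = ccw <%O u c a b.
Proof. by rewrite [LHS]ccwC ccwC. Qed.

Section Rotation.
Variable u : int -> bool.

Lemma ccw_rot a b c : ccw <%O (rot_label u) (- a) (- b) (- c) = ccw <%O u a b c.
Proof.
rewrite /ccw /circle_lt /rot_label !opprK !ltrN2.
by case: (u a); case: (u b); case: (u c); rewrite /= ?andbT ?andbF ?orbF ?orbT //;
  do ![case: (_ < _) => //=].
Qed.

(** Exchanging the two sides is a reflection of the strip. *)
Lemma ccw_negb a b c : ccw <%O (negb \o u) a b c = ccw <%O u c b a.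
Proof.
rewrite /ccw /circle_lt /=.
by case: (u a); case: (u b); case: (u c); rewrite /= ?andbT ?andbF ?orbF ?orbT //;
  do ![case: (_ < _) => //=].
Qed.

Lemma crossing_rot x y :
  crossing <%O (rot_label u) (rot_edge x) (rot_edge y) = crossing <%O u x y.
Proof.
rewrite /crossing; cbn [fst snd rot_edge]; rewrite !ccw_rot.
rewrite (ccwC2 u x.2 y.2) (ccwC2 u x.2 y.1) !(ccwC u x.2 x.1).
by rewrite orbC andbC [X in _ || X]andbC orbC.
Qed.

Lemma crossing_rev x y :
  crossing <%O (negb \o u) (rev_edge x) (rev_edge y) = crossing <%O u x y.
Proof.
rewrite /crossing; cbn [fst snd rev_edge]; rewrite !ccw_negb.
by rewrite orbC !(ccwC u _ x.1 x.2).
Qed.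

Lemma parallel_rot x y : parallel (rot_edge x) (rot_edge y) = parallel x y.
Proof.
by rewrite /parallel /= !eqr_opp andbC [X in _ || X]andbC.
Qed.

Lemma parallel_rev x y : parallel (rev_edge x) (rev_edge y) = parallel x y.
Proof. by rewrite /parallel /= andbC [X in _ || X]andbC. Qed.

Lemma and4_swap (a b c d : bool) : [&& a, b, c & d] = [&& b, a, d & c].
Proof. by case: a b c d => [] [] [] []. Qed.

Lemma compatible_rot x y :
  compatible <%O (rot_label u) (rot_edge x) (rot_edge y) = compatible <%O u x y.
Proof.
rewrite /compatible crossing_rot parallel_rot /positive_first /positive.
cbn [fst snd rot_edge]; rewrite !ccw_rot !ltrN2 !eqr_opp.
by congr [&& _, _ & _]; rewrite and4_swap.
Qed.

Lemma heads_slid_rot x y :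
  heads_slid <%O (rot_label u) (rot_edge x) (rot_edge y) = tails_slid <%O u x y.
Proof.
rewrite /heads_slid /tails_slid crossing_rot parallel_rot /positive.
by cbn [fst snd rot_edge]; rewrite !ccw_rot !ltrN2 !eqr_opp.
Qed.

(** The reflection reverses the cyclic order and the reversal exchanges the signs; in
    [positive_first] the two effects cancel. Distinct ends ensure that exactly one of an arc and its
    reverse is positive. *)
Lemma compatible_rev x y : x.1 != x.2 -> y.1 != y.2 ->
  compatible <%O (negb \o u) (rev_edge x) (rev_edge y) = compatible <%O u x y.
Proof.
move=> nx ny.
rewrite /compatible crossing_rev parallel_rev /positive_first /positive.
cbn [fst snd rev_edge]; rewrite !ccw_negb.
have -> : (x.2 < x.1) = ~~ (x.1 < x.2) by lia.
have -> : (y.2 < y.1) = ~~ (y.1 < y.2) by lia.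
rewrite !(inj_eq negb_inj) !if_neg.
rewrite !(ccwC u _ x.1 x.2) !(ccwC2 u _ x.2 x.1).
rewrite !(ccwC2 u x.2 _ x.1) !(ccwC u x.2 x.1).
by congr [&& _, _ & _]; rewrite and4_swap.
Qed.

Lemma crossing_rev_same x y :
  crossing <%O u (rev_edge x) (rev_edge y) = crossing <%O u x y.
Proof.
rewrite /crossing; cbn [fst snd rev_edge].
rewrite !(ccwC2 u x.2 _ x.1) !(ccwC u x.2 x.1).
by rewrite orbC andbC [X in _ || X]andbC orbC.
Qed.

Lemma compatible_negative x y : x.1 != x.2 -> y.1 != y.2 ->
  (x.1 < x.2) = (y.1 < y.2) ->
  compatible <%O u (rev_edge x) (rev_edge y) = compatible <%O u x y.
Proof.
move=> nx ny xy.
have xy' : (x.2 < x.1) = (y.2 < y.1) by lia.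
rewrite /compatible crossing_rev_same parallel_rev /positive_first /positive.
cbn [fst snd rev_edge]; rewrite xy xy' !eqxx /= !implybT !implybF.
by congr [&& _, _ & _]; rewrite and4_swap.
Qed.

End Rotation.

Definition shift_edge (N k : int) x : edge := (x.1 + k * N, x.2 + k * N).

Definition periodic (N : int) u := forall a, u (a + N) = u a.

Lemma periodicM N u k a : periodic N u -> u (a + k * N) = u a.
Proof.
move=> perN.
have perNn m b : u (b + m%:Z * N) = u b.
  elim: m b => [|m IHm] b; first by rewrite mul0r addr0.
  by rewrite -addn1 PoszD mulrDl mul1r addrA perN IHm.
case: (intP k) => [|m|m]; first by rewrite mul0r addr0.
  exact: perNn.
by rewrite -(perNn m.+1) -addrA mulNr addNr addr0.
Qed.

Lemma periodic_rot N u : periodic N u -> periodic N (rot_label u).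
Proof.
by move=> perN a; rewrite /rot_label opprD -(perN (- a - N)) subrK.
Qed.

Lemma rot_shift N k x : rot_edge (shift_edge N k x) = shift_edge N (- k) (rot_edge x).
Proof. by rewrite /rot_edge /shift_edge /= !opprD !mulNr. Qed.

(** * Sliding arcs *)

Section Slides.
Variables (N : int) (u : int -> bool).
Hypotheses (N_gt0 : 0 < N) (u_per : periodic N u).

Local Notation sh := (shift_edge N).

Lemma ccw_shift k a b c :
  ccw <%O u (a + k * N) (b + k * N) (c + k * N) = ccw <%O u a b c.
Proof. by rewrite /ccw /circle_lt !(periodicM _ _ u_per) !ltrD2r. Qed.

Lemma compatible_shift k x y :
  compatible <%O u (sh k x) (sh k y) = compatible <%O u x y.
Proof.
rewrite /compatible /crossing /parallel /positive_first /positive.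
by cbn [fst snd shift_edge]; rewrite !ccw_shift !ltrD2r !(inj_eq (addIr _)).
Qed.

Lemma shift_add k l x : sh k (sh l x) = sh (l + k) x.
Proof. by rewrite /shift_edge /= !mulrDl !addrA. Qed.

Lemma shift0 x : sh 0 x = x.
Proof. by case: x => a b; rewrite /shift_edge /= mul0r !addr0. Qed.

(** The arc [x] starts at the head of a translate of [z], and counterclockwise from there the tail
    of that translate comes before the head of [x]. *)
Definition slides_tail z x :=
  (N %| x.1 - z.2)%Z && ccw <%O u x.1 (x.1 - (z.2 - z.1)) x.2.

Definition slide_tail z x : edge :=
  if slides_tail z x then (x.1 - (z.2 - z.1), x.2) else x.

Lemma slide_tail_shift z k x : slide_tail z (sh k x) = sh k (slide_tail z x).
Proof.
rewrite /slide_tail /slides_tail /=.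
rewrite addrAC rpredDr ?dvdz_mull // [x.1 + _ - _]addrAC ccw_shift.
by case: ifP.
Qed.

Variable z : edge.
Hypotheses (z_pos : z.1 < z.2) (z_ndvd : ~~ (N %| z.2 - z.1)%Z).
Hypothesis z_self : forall k, k != 0 -> compatible <%O u z (sh k z).

Variant slide_tail_spec x : bool -> edge -> Type :=
| SlidTail k of x.1 = z.2 + k * N & ccw <%O u (z.2 + k * N) (z.1 + k * N) x.2 :
    slide_tail_spec x true (z.1 + k * N, x.2)
| UnslidTail of (forall k, ~~ ((x.1 == z.2 + k * N) &&
                   ccw <%O u (z.2 + k * N) (z.1 + k * N) x.2)) :
    slide_tail_spec x false x.

Lemma slide_tailP x : slide_tail_spec x (slides_tail z x) (slide_tail z x).
Proof.
rewrite /slide_tail; case: ifP.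
  case/andP=> /dvdzP/sig_eqW[k xE] cx.
  have x1 : x.1 = z.2 + k * N by rewrite -xE; lia.
  have x1' : x.1 - (z.2 - z.1) = z.1 + k * N by rewrite x1; lia.
  by rewrite x1'; apply: SlidTail => //; rewrite -x1 -x1'.
move=> /negbT nx; apply: UnslidTail => k; apply: contra nx.
case/andP=> /eqP xE cx; rewrite /slides_tail xE.
have -> : z.2 + k * N - z.2 = k * N by lia.
have -> : z.2 + k * N - (z.2 - z.1) = z.1 + k * N by lia.
by rewrite dvdz_mull.
Qed.

Lemma z_lifts k l : k != l -> compatible <%O u (sh k z) (sh l z).
Proof.
move=> nkl; have := z_self (k := l - k); rewrite subr_eq0 eq_sym => /(_ nkl).
by rewrite -(compatible_shift k) shift_add subrK.
Qed.

Lemma lifts_same_direction k l : k != l ->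
  same_direction <%O u (z.1 + k * N) (z.2 + k * N) (z.1 + l * N) (z.2 + l * N).
Proof.
move=> nkl; rewrite /same_direction !(periodicM _ _ u_per) !eqxx !ltrD2l eqxx ltrD2r.
have ndvd m : z.2 - z.1 != m * N.
  by apply: contraNneq z_ndvd => ->; rewrite dvdz_mull.
rewrite z_pos /= andbT.
by move: (ndvd (l - k)) (ndvd (k - l)); rewrite !mulrBl; lia.
Qed.

Let slidz x := forall k, slidable <%O u x (sh k z).

Lemma slide_tail_compatible x y : slidz x -> slidz y -> compatible <%O u x y ->
  compatible <%O u (slide_tail z x) (slide_tail z y).
Proof.
have one k x' y' : x'.1 = z.2 + k * N -> slidable <%O u x' (sh k z) ->
    slidable <%O u y' (sh k z) ->
    ccw <%O u (z.2 + k * N) (z.1 + k * N) x'.2 ->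
    ~~ ((y'.1 == z.2 + k * N) && ccw <%O u (z.2 + k * N) (z.1 + k * N) y'.2) ->
    compatible <%O u x' y' -> compatible <%O u (z.1 + k * N, x'.2) y'.
  case: x' y' => a b [c d] /= -> sx sy cb ncd xy.
  have := @slide_oneP u (z.1 + k * N) (z.2 + k * N) b c d.
  rewrite /slid_slidable cb sx ltrD2r z_pos => /(_ isT)/implyP/(_ xy).
  by move=> /implyP/(_ sy)/implyP/(_ ncd).
move=> sx sy xy; case: (slide_tailP x) => [k xE cx|nx]; last first.
  case: (slide_tailP y) => [l yE cy|ny //].
  by rewrite compatibleC; apply: one => //; rewrite compatibleC.
case: (slide_tailP y) => [l yE cy|ny]; last exact: one.
have [lk|nlk] := eqVneq l k.
  rewrite lk in yE cy *.
  move: (sx k) (sy k) xy; rewrite (surjective_pairing x) (surjective_pairing y).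
  rewrite xE yE => sxk syk xy.
  have := @slide_bothP u (z.1 + k * N) (z.2 + k * N) x.2 (z.2 + k * N) y.2.
  rewrite /slid_slidable cx ltrD2r z_pos sxk => /(_ isT)/implyP/(_ (eqxx _)).
  by move=> /implyP/(_ xy)/implyP/(_ syk)/implyP/(_ cy).
(* Both tails slide, along different translates: [x] slides first and remains slidable along the
   translate met by [y], then [y] slides. *)
have sx' : slidable <%O u (z.1 + k * N, x.2) (sh l z).
  have := @slide_slidableP u (z.1 + k * N) (z.2 + k * N) x.2
    (z.1 + l * N) (z.2 + l * N).
  move: (sx k) (sx l); rewrite (surjective_pairing x) xE => sxk sxl.
  rewrite /slid_slidable cx ltrD2r z_pos sxk => /(_ isT)/implyP.
  move=> /(_ (lifts_same_direction _))/implyP; rewrite eq_sym => /(_ nlk).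
  by move=> /(_ (z_lifts _))/implyP; rewrite eq_sym; apply.
rewrite compatibleC; apply: (one l) => //=.
  rewrite negb_and; apply/orP; left.
  apply: contraNneq z_ndvd => zE; apply/dvdzP; exists (k - l).
  by rewrite mulrBl; lia.
rewrite compatibleC; apply: one => //.
rewrite yE negb_and; apply/orP; left.
by rewrite (inj_eq (addrI _)) (inj_eq (mulIf _)) //; lia.
Qed.

(** The position relative to [z] halfway through a mutation; after a half-turn it is what the second
    slide starts from. *)
Lemma slide_tail_tails_slid x k : (forall k, compatible <%O u x (sh k z)) ->
  tails_slid <%O u (slide_tail z x) (sh k z).
Proof.
move=> cx; case: (slide_tailP x) => [l xE cl|nx]; last first.
  have := @unslid_tailsP u (z.1 + k * N) (z.2 + k * N) (z.1 + k * N) x.1 x.2.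
  rewrite /four_points_lt ltrD2r z_pos eqxx => /(_ isT)/implyP.
  by rewrite -surjective_pairing => /(_ (cx k))/implyP/(_ (nx k)).
move: (cx k) (cx l); rewrite (surjective_pairing x) xE => cxk cxl.
have := @slide_tailsP u (z.1 + l * N) (z.2 + l * N) x.2
    (z.1 + k * N) (z.2 + k * N).
rewrite /slid_compatible cl ltrD2r z_pos cxl => /(_ isT)/andP[].
have [<- //|nlk _] := eqVneq l k.
move=> /implyP/(_ (lifts_same_direction nlk))/implyP/(_ (z_lifts nlk)).
by move/implyP/(_ cxk).
Qed.

(** Applied in the rotated strip, this is the second half of a mutation, at the end of which [z]
    gets reversed. *)
Lemma slide_tail_heads_slid x k : (forall k, heads_slid <%O u x (sh k z)) ->
  compatible <%O u (slide_tail z x) (rev_edge (sh k z)).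
Proof.
move=> cx; case: (slide_tailP x) => [l xE cl|nx]; last first.
  have := @unslid_headsP u (z.1 + k * N) (z.2 + k * N) (z.1 + k * N) x.1 x.2.
  rewrite /four_points_lt ltrD2r z_pos eqxx => /(_ isT)/implyP.
  by rewrite -surjective_pairing => /(_ (cx k))/implyP/(_ (nx k)).
move: (cx k) (cx l); rewrite (surjective_pairing x) xE => cxk cxl.
have := @slide_headsP u (z.1 + l * N) (z.2 + l * N) x.2
    (z.1 + k * N) (z.2 + k * N).
rewrite /slid_heads cl ltrD2r z_pos cxl => /(_ isT)/andP[].
have [<- //|nlk _] := eqVneq l k.
move=> /implyP/(_ (lifts_same_direction nlk))/implyP/(_ (z_lifts nlk)).
by move/implyP/(_ cxk).
Qed.

Lemma compatible_slidable x k : compatible <%O u x (sh k z) ->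
  slidable <%O u x (sh k z).
Proof.
have := @slidableP u (z.1 + k * N) (z.2 + k * N) (z.1 + k * N) x.1 x.2.
rewrite /four_points_lt ltrD2r z_pos eqxx => /(_ isT)/implyP.
by rewrite -surjective_pairing => + xz; apply; rewrite xz.
Qed.

Lemma heads_slid_slidable x k : heads_slid <%O u x (sh k z) ->
  slidable <%O u x (sh k z).
Proof.
have := @slidableP u (z.1 + k * N) (z.2 + k * N) (z.1 + k * N) x.1 x.2.
rewrite /four_points_lt ltrD2r z_pos eqxx => /(_ isT)/implyP.
by rewrite -surjective_pairing => + xz; apply; rewrite xz orbT.
Qed.

End Slides.

Definition slide_head N u z x : edge :=
  rot_edge (slide_tail N (rot_label u) (rot_edge z) (rot_edge x)).

Definition slides_head N u z x :=
  (N %| x.2 - z.1)%Z && ccw <%O u x.2 (x.2 + (z.2 - z.1)) x.1.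

Lemma slide_headE N u z x :
  slide_head N u z x =
  if slides_head N u z x then (x.1, x.2 + (z.2 - z.1)) else x.
Proof.
rewrite /slide_head /slide_tail /slides_tail /slides_head /=.
have -> : - z.1 - - z.2 = z.2 - z.1 by lia.
rewrite -!opprD ccw_rot rpredN ?opprK.
by case: ifP; rewrite /rot_edge /= !opprK // -surjective_pairing.
Qed.

(* A mutation at [z] adds to [x] as many copies of [z] as [x] has ends sliding
   along translates of [z]. *)
Definition slide N u z x : edge := slide_head N u z (slide_tail N u z x).

Lemma rot_edgeK : involutive rot_edge.
Proof. by case=> a b; rewrite /rot_edge /= !opprK. Qed.

Lemma slide_shift N u z k x : periodic N u ->
  slide N u z (shift_edge N k x) = shift_edge N k (slide N u z x).
Proof.
move=> u_per; rewrite /slide /slide_head slide_tail_shift // rot_shift.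
by rewrite slide_tail_shift ?rot_shift ?opprK //; exact: periodic_rot.
Qed.

Section Slide.
Variables (N : int) (u : int -> bool) (z : edge).
Hypotheses (N_gt0 : 0 < N) (u_per : periodic N u).
Hypotheses (z_pos : z.1 < z.2) (z_ndvd : ~~ (N %| z.2 - z.1)%Z).
Hypothesis z_self : forall k, k != 0 -> compatible <%O u z (shift_edge N k z).

Let rz_pos : (rot_edge z).1 < (rot_edge z).2. Proof. by rewrite /= ltrN2. Qed.

Let rz_ndvd : ~~ (N %| (rot_edge z).2 - (rot_edge z).1)%Z.
Proof. by rewrite /= opprK addrC. Qed.

Let rz_self k : k != 0 ->
  compatible <%O (rot_label u) (rot_edge z) (shift_edge N k (rot_edge z)).
Proof.
move=> k0; rewrite -[k]opprK -rot_shift compatible_rot.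
by apply: z_self; rewrite oppr_eq0.
Qed.

Lemma slide_tail_heads x k : (forall k, compatible <%O u x (shift_edge N k z)) ->
  heads_slid <%O (rot_label u) (rot_edge (slide_tail N u z x))
    (shift_edge N k (rot_edge z)).
Proof.
move=> cx; rewrite -[k]opprK -rot_shift heads_slid_rot.
exact: slide_tail_tails_slid.
Qed.

Lemma slide_compatible x y : (forall k, compatible <%O u x (shift_edge N k z)) ->
  (forall k, compatible <%O u y (shift_edge N k z)) -> compatible <%O u x y ->
  compatible <%O u (slide N u z x) (slide N u z y).
Proof.
move=> cx cy xy; rewrite -compatible_rot /slide /slide_head !rot_edgeK.
apply: slide_tail_compatible => //; first exact: periodic_rot.
- by move=> k; apply: heads_slid_slidable => //; exact: slide_tail_heads.
- by move=> k; apply: heads_slid_slidable => //; exact: slide_tail_heads.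
rewrite compatible_rot; apply: slide_tail_compatible => //.
- by move=> k; exact: compatible_slidable.
- by move=> k; exact: compatible_slidable.
Qed.

Lemma slide_compatible_rev x k :
  (forall k, compatible <%O u x (shift_edge N k z)) ->
  compatible <%O u (slide N u z x) (shift_edge N k (rev_edge z)).
Proof.
move=> cx; rewrite -compatible_rot /slide /slide_head rot_edgeK rot_shift.
apply: slide_tail_heads_slid => //; first exact: periodic_rot.
by move=> l; exact: slide_tail_heads.
Qed.

End Slide.

(** An arc on one side longer than [N] would cross its translate by [N]; length exactly [N] is
    excluded by the divisibility hypothesis. *)
Lemma same_label_short N u x : 0 < N -> periodic N u ->
  ~~ (N %| x.2 - x.1)%Z -> compatible <%O u x (shift_edge N 1 x) ->
  u x.1 = u x.2 -> `|x.2 - x.1| < N.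
Proof.
case: x => a b /= N0 u_per ndvd /and3P[+ _ _] uab.
have nN : b - a != N by apply: contraNneq ndvd => ->; exact: dvdzz.
have nN' : b - a != - N by apply: contraNneq ndvd => ->; rewrite rpredN dvdzz.
rewrite /crossing /ccw /circle_lt /= !mul1r !u_per uab; case: (u b) => /=; lia.
Qed.

Lemma dvdz_sub_trans (N a b c : int) :
  (N %| a - b)%Z -> (N %| a - c)%Z -> (N %| b - c)%Z.
Proof.
move=> ab ac; have -> : b - c = a - c - (a - b) by clear; lia.
by apply: rpredB.
Qed.

(** * Seeds of arcs and their mutation *)

Section Seeds.
Variables (I : eqType) (N : int) (u : int -> bool).
Hypotheses (N_gt0 : 0 < N) (u_per : periodic N u).
Implicit Types (e : I -> edge).

Local Notation sh := (shift_edge N).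

(** The first clause, an arc between the two sides, rules out a closed chain along one side; the
    second says that no arc is closed in the annulus. In the third, [i = j] with [k != 0] compares
    an arc with its own translates. *)
Definition noncrossing_seed u e : Prop :=
  [/\ exists j, u (e j).1 != u (e j).2,
      forall j, ~~ (N %| (e j).2 - (e j).1)%Z
    & forall i j k, (i != j) || (k != 0) -> compatible <%O u (e i) (sh k (e j))].

Lemma edge_neq x : ~~ (N %| x.2 - x.1)%Z -> x.1 != x.2.
Proof. by apply: contraNneq => ->; rewrite subrr dvdz0. Qed.

Lemma noncrossing_seed_rev e : noncrossing_seed u e ->
  noncrossing_seed (negb \o u) (fun j => rev_edge (e j)).
Proof.
case=> [[j uj] nd cp]; split=> [|i|i l k ilk].
- by exists j; move: uj; rewrite /=; case: (u _); case: (u _).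
- by rewrite /= -opprB rpredN nd.
rewrite [sh _ _](_ : _ = rev_edge (sh k (e l))) // compatible_rev ?cp //.
  exact/edge_neq/nd.
by rewrite /= (inj_eq (addIr _)) edge_neq.
Qed.

Definition mutate_edges u k e j :=
  if j == k then rev_edge (e k) else slide N u (e k) (e j).

Section Mutation.
Variables (e : I -> edge) (k : I).
Hypotheses (e_seed : noncrossing_seed u e) (k_pos : (e k).1 < (e k).2).
Let z := e k.

Let z_ndvd : ~~ (N %| z.2 - z.1)%Z. Proof. by case: e_seed => _ nd _; exact: nd. Qed.
Let z_self l : l != 0 -> compatible <%O u z (sh l z).
Proof. by case: e_seed => _ _ cp l0; apply: cp; rewrite l0 orbT. Qed.

(* A chain of two edges with equal labels winding once around the annulus would
   enclose one of its two sides, and leave no room for an edge between the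
   sides. *)
Lemma antiparallel_labels j : j != k -> (N %| (e j).1 - z.2)%Z ->
  (N %| (e j).2 - z.1)%Z -> u z.1 != u z.2.
Proof.
move=> jk /dvdzP[m1 E1] /dvdzP[m2 E2]; apply/negP => /eqP uz.
have [[i ui] nd cp] := e_seed.
pose y := sh (- m1) (e j).
have y1 : y.1 = z.2 by rewrite /= mulNr; lia.
have [m y2] : exists m, y.2 = z.1 + m * N.
  by exists (m2 - m1); rewrite /= mulNr mulrBl; lia.
have zy l : compatible <%O u z (sh l y) by rewrite shift_add cp // eq_sym jk.
have uy : u y.1 = u y.2 by rewrite y2 y1 (periodicM _ _ u_per).
have yN : `|y.2 - y.1| < N.
  apply: same_label_short uy => //.
    by rewrite y1 y2 -(rpredBr (x := m * N)) ?dvdz_mull //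
       (_ : _ - _ - _ = - (z.2 - z.1)) ?rpredN //; lia.
  by rewrite shift_add addrC -shift_add compatible_shift // cp // orbT.
have zN : `|z.2 - z.1| < N.
  by apply: same_label_short uz => //; exact: z_self.
(* The lengths of [z] and [y] add up to [m * N]. Both arcs are shorter than [N], [z] is positive,
   and [m = 0] would make them parallel. So [y] closes the chain after one turn. *)
have m1E : m = 1.
  have : m != 0.
    apply/eqP => m0; have /and3P[_ + _] := zy 0.
    by rewrite shift0 /parallel y1 y2 m0 mul0r addr0 !eqxx orbT.
  move: yN zN k_pos; rewrite y2 y1 -/z => yN zN zpos m0.
  have : m * N < 2 * N by lia.
  have : - N < m * N by lia.
  rewrite -mulN1r !ltr_pM2r //; lia.
rewrite {}m1E mul1r in y2.
pose yE := (z.2, z.1 + N).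
have yEE : y = yE by rewrite [y]surjective_pairing y1 y2.
(* The end [w] of an arc to the other side is either strictly covered by an arc of the chain or a
   common end of two consecutive ones; [coveredP] excludes both. *)
have bridge x w a : u w = u z.1 -> z.1 <= w < z.1 + N -> u a != u w ->
    x = (w, a) \/ x = (a, w) -> (forall l, compatible <%O u x (sh l z)) ->
    (forall l, compatible <%O u x (sh l yE)) -> False.
  move=> uw wN ua xE xz xy.
  have cov p q : p < w -> w < q -> u p = u w -> u q = u w ->
      ~ (compatible <%O u x (p, q) \/
         compatible <%O u x (p, w) /\ compatible <%O u x (w, q)).
    move=> pw wq up uq; have := @coveredP u p q w a w.
    rewrite /consecutive pw wq up uq eqxx => /(_ isT)/implyP/(_ ua).
    rewrite !negb_or; case: xE => <- /and4P[h1 h2 h3 h4] [c0|[c1 c2]];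
      by move: h1 h2 h3 h4; rewrite ?c0 ?c1 ?c2.
  have uN : u (z.1 + N) = u z.1 by rewrite u_per.
  have uN' : u (z.2 - N) = u z.2 by rewrite -(u_per (z.2 - N)) subrK.
  have := xz 0; have := xy 0; have := xy (-1).
  rewrite !shift0 {1}/shift_edge /= !mulN1r addrK => xy' xy0 xz0.
  have zE : z = (z.1, z.2) by case: (z).
  rewrite zE in xz0.
  have [wz|wz|wz] := ltgtP w z.2.
  - have [pw|pw] := ltP z.1 w.
      by apply: (cov z.1 z.2); rewrite ?uw ?uz //; left.
    have wE : w = z.1 by move: pw wN; clear; lia.
    apply: (cov (z.2 - N) z.2); rewrite ?uN' ?uw ?uz //.
      by move: wE zN k_pos; rewrite -/z; clear; lia.
    by right; rewrite wE; split.
  - apply: (cov z.2 (z.1 + N)); rewrite ?uN ?uw ?uz //.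
      by move: wN; clear; lia.
    by left.
  - apply: (cov z.1 (z.1 + N)); rewrite ?uN ?uw //.
    - by rewrite wz.
    - by move: wN; clear; lia.
    by right; rewrite wz; split.
have reduce w : exists l, z.1 <= w + l * N < z.1 + N.
  exists (- ((w - z.1) %/ N)%Z); have := divz_eq (w - z.1) N.
  have : 0 <= ((w - z.1) %% N)%Z < N by rewrite modz_ge0 ?ltz_pmod ?gt_eqF.
  by rewrite mulNr; clear; lia.
have ik : i != k by apply: contraNneq ui => ->; rewrite uz.
have ij : i != j.
  apply: contraNneq ui => ->.
  by move: uy; rewrite /= !(periodicM _ _ u_per) => ->.
have xz l l' : compatible <%O u (sh l (e i)) (sh l' z).
  by rewrite -[l'](subrK l) -shift_add compatible_shift // cp // ik.
have xy l l' : compatible <%O u (sh l (e i)) (sh l' yE).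
  rewrite -yEE shift_add -[_ + l'](subrK l) -shift_add compatible_shift //.
  by rewrite cp // ij.
have [u1|u1] := eqVneq (u (e i).1) (u z.1).
  have [l wl] := reduce (e i).1.
  apply: (bridge (sh l (e i)) ((e i).1 + l * N) ((e i).2 + l * N)) => //.
  - by rewrite (periodicM _ _ u_per).
  - by rewrite !(periodicM _ _ u_per) // eq_sym.
  - by left.
have [l wl] := reduce (e i).2.
apply: (bridge (sh l (e i)) ((e i).2 + l * N) ((e i).1 + l * N)) => //.
- by rewrite (periodicM _ _ u_per); move: ui u1; do 3 case: (u _).
- by rewrite !(periodicM _ _ u_per).
- by right.
Qed.

(** Here [e j] and [z] join the same two points of the annulus in opposite directions, and these lie
    on different sides. Both ends slide or neither does, and sliding the tail first does not change
    the test at the head. *)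
Lemma slides_both j : j != k -> (N %| (e j).1 - z.2)%Z ->
  (N %| (e j).2 - z.1)%Z ->
  (slides_head N u z (slide_tail N u z (e j)) = slides_tail N u z (e j)) *
  (slides_head N u z (e j) = slides_tail N u z (e j)).
Proof.
move=> jk d1 d2; have uz := antiparallel_labels jk d1 d2.
have [_ _ cp] := e_seed.
move: (d1) (d2) => /dvdzP[k1 E1] /dvdzP[k2 E2].
pose m := k2 - k1.
have y1 : (e j).1 = z.2 + k1 * N by rewrite -E1 addrC subrK.
have y2 : (e j).2 = z.1 + m * N + k1 * N.
  by rewrite /m mulrBl -addrA subrK -E2 addrC subrK.
have y1' : (e j).1 - (z.2 - z.1) = z.1 + k1 * N by rewrite y1; clear; lia.
have y2' : (e j).2 + (z.2 - z.1) = z.2 + m * N + k1 * N by rewrite y2; clear; lia.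
have ejE : sh (- k1) (e j) = (z.2, z.1 + m * N).
  by rewrite /shift_edge y1 y2 mulNr !addrK.
have cz l : compatible <%O u (z.2, z.1 + m * N) (sh l z).
  by rewrite -ejE -[l](subrK (- k1)) -shift_add compatible_shift // cp // jk.
have zE : z = (z.1, z.2) by case: (z).
have m0 : 0 != m.
  apply/eqP => m0; have := cz 0.
  by rewrite -m0 mul0r addr0 shift0 zE => /and3P[_ + _]; rewrite /parallel !eqxx orbT.
have := lifts_same_direction N_gt0 u_per k_pos z_ndvd m0.
rewrite !mul0r !addr0 => zdir.
have := @kroneckerP u z.1 z.2 z.1 (z.1 + m * N) (z.2 + m * N).
rewrite /four_points_lt k_pos eqxx => /(_ isT)/implyP/(_ zdir)/implyP/(_ uz).
have := z_lifts u_per z_self m0; rewrite shift0 {1}zE => zz /implyP/(_ zz).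
have := cz 0; rewrite shift0 zE => c0 /implyP/(_ c0)/implyP/(_ (cz m)).
have tE : ccw <%O u (e j).1 ((e j).1 - (z.2 - z.1)) (e j).2 =
    ccw <%O u z.2 z.1 (z.1 + m * N) by rewrite y1' y1 y2 ccw_shift.
have hE : ccw <%O u (e j).2 ((e j).2 + (z.2 - z.1)) (e j).1 =
    ccw <%O u (z.1 + m * N) (z.2 + m * N) z.2 by rewrite y2' y1 y2 ccw_shift.
have hE' : ccw <%O u (e j).2 ((e j).2 + (z.2 - z.1)) ((e j).1 - (z.2 - z.1)) =
    ccw <%O u (z.1 + m * N) (z.2 + m * N) z.1 by rewrite y2' y1' y2 ccw_shift.
rewrite /slides_head /slide_tail /slides_tail d1 d2 tE hE /= -/z.
by case: ifP => _ /= => [/andP[]|/negbTE]; rewrite d2 ?hE ?hE' => ->.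
Qed.

Definition slide_count j :=
  (slides_tail N u z (e j) + slides_head N u z (slide_tail N u z (e j)))%N.

(** An arc sliding at one end only could close up only if its other end met [z] too, but then
    [slides_both] makes both ends slide. *)
Lemma slide_ndvd j : j != k ->
  ~~ (N %| (slide N u z (e j)).2 - (slide N u z (e j)).1)%Z.
Proof.
move=> jk; have [_ nd _] := e_seed.
rewrite /slide slide_headE.
case t: (slides_tail N u z (e j)); case h: (slides_head N u z _);
  rewrite /slide_tail t in h *.
- move: t h => /andP[d1 _] /andP[/= d2 _]; apply: contra z_ndvd => d.
  have -> : z.2 - z.1 = (e j).2 + (z.2 - z.1) - ((e j).1 - (z.2 - z.1)) -
     ((e j).2 - z.1) + ((e j).1 - z.2) by clear; lia.
  by rewrite rpredD // rpredB.
- move: (t) => /andP[d1 _]; apply: contraFN h => /= d.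
  have d2 : (N %| (e j).2 - z.1)%Z.
    have -> : (e j).2 - z.1 = (e j).2 - ((e j).1 - (z.2 - z.1)) +
      ((e j).1 - z.2) by clear; lia.
    by rewrite rpredD.
  by have := (slides_both jk d1 d2).1; rewrite /slide_tail t => ->.
- move: (h) => /andP[d2 _]; apply: contraFN (t) => /= d.
  have d1 : (N %| (e j).1 - z.2)%Z.
    have -> : (e j).1 - z.2 = (e j).2 - z.1 -
      ((e j).2 + (z.2 - z.1) - (e j).1) by clear; lia.
    by rewrite rpredB.
  by have := (slides_both jk d1 d2).1; rewrite /slide_tail t h.
- exact: nd.
Qed.

Lemma slide_labels x : u z.1 = u z.2 ->
  (u (slide N u z x).1 = u x.1) * (u (slide N u z x).2 = u x.2).
Proof.
move=> uz; have tailu y : (u (slide_tail N u z y).1 = u y.1) *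
    (u (slide_tail N u z y).2 = u y.2).
  rewrite /slide_tail; case: ifP => // /andP[/dvdzP[l E] _] /=; split=> //.
  have -> : y.1 - (z.2 - z.1) = z.1 + l * N by rewrite -E; clear; lia.
  have -> : y.1 = z.2 + l * N by rewrite -E; clear; lia.
  by rewrite !(periodicM _ _ u_per).
rewrite -[u x.1](tailu x).1 -[u x.2](tailu x).2 /slide slide_headE.
move: (slide_tail _ _ _ _) => y.
case: ifP => // /andP[/dvdzP[l E] _] /=; split=> //.
have -> : y.2 + (z.2 - z.1) = z.2 + l * N by rewrite -E; clear; lia.
have -> : y.2 = z.1 + l * N by rewrite -E; clear; lia.
by rewrite !(periodicM _ _ u_per).
Qed.

Lemma mutate_noncrossing_seed : noncrossing_seed u (mutate_edges u k e).
Proof.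
have [[j uj] nd cp] := e_seed.
have cz i l : i != k -> compatible <%O u (e i) (sh l z).
  by move=> ik; rewrite cp // ik.
split=> [|i|i i' l ii'].
(* An arc between the sides persists: if [z] is one, so is its reverse; otherwise sliding along [z]
   keeps every end on its side. *)
- have [uz|uz] := eqVneq (u z.1) (u z.2); last first.
    by exists k; rewrite /mutate_edges eqxx eq_sym.
  exists j; rewrite /mutate_edges; case: (eqVneq j k) => [jk|_].
    by rewrite jk uz eqxx in uj.
  by rewrite !slide_labels.
- rewrite /mutate_edges; case: (eqVneq i k) => [_|ik]; last exact: slide_ndvd.
  by rewrite /= -opprB rpredN.
rewrite /mutate_edges; have [ik|ik] := eqVneq i k; have [i'k|i'k] := eqVneq i' k.
- rewrite ik i'k eqxx /= in ii'.
  rewrite [sh _ _](_ : _ = rev_edge (sh l z)) // compatible_negative ?z_self //.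
  + exact: edge_neq.
  + by rewrite /= (inj_eq (addIr _)) edge_neq.
  + by rewrite /= ltrD2r.
- rewrite compatibleC -(compatible_shift u_per (- l)) shift_add subrr shift0.
  by apply: slide_compatible_rev => // m; exact: cz.
- by apply: slide_compatible_rev => // m; exact: cz.
rewrite -slide_shift //; apply: slide_compatible => //.
- by move=> m; exact: cz.
- move=> m; rewrite -[m](subrK l) -shift_add compatible_shift //.
  exact: cz.
- exact: cp.
Qed.

End Mutation.
End Seeds.

(** * The exchange form *)

Lemma sum_leq_ord (M b : nat) : (b <= M)%N ->
  (\sum_(i < M) (b <= i) = M - b)%N.
Proof.
elim: M => [|M IHM] bM; first by rewrite big_ord0 sub0n.
rewrite big_ord_recr /=; have [bM'|Mb] := leqP b M.
  by rewrite IHM // addn1 subSn.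
have -> : b = M.+1 by lia.
by rewrite subnn addn0 big1 // => i _; have := ltn_ord i; lia.
Qed.

Section Window.
Variables (N : int) (K : nat).
Hypothesis N_gt0 : 0 < N.

(** Signs of translates have infinitely many nonzero terms; the symmetric cutoff lets the distant
    ones cancel. *)
Definition window_sum (F : int -> int) : int :=
  \sum_(i < K.*2.+1) F (i%:Z - K%:Z).

Lemma window_sum_geq a : - (K%:Z + 1) <= a <= K%:Z ->
  window_sum (fun m => (0 <= a + m)%R%:Z) = K%:Z + 1 + a.
Proof.
move=> aK; rewrite /window_sum.
rewrite (eq_bigr (fun i : 'I__ => ((absz (K%:Z - a)%R <= i)%N)%:Z)); last first.
  by move=> i _; congr (Posz (nat_of_bool _)); lia.
by rewrite -(big_morph _ PoszD (erefl 0%:Z)) sum_leq_ord; lia.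
Qed.

Lemma window_sum_leq a : - (K%:Z + 1) <= a <= K%:Z ->
  window_sum (fun m => (m <= a)%R%:Z) = K%:Z + 1 + a.
Proof.
move=> aK; have -> : window_sum (fun m => (m <= a)%R%:Z) =
    window_sum (fun m => 1 - (0 <= - (a + 1) + m)%R%:Z).
  by apply: eq_bigr => i _; case: leP; case: leP; lia.
have := @window_sum_geq (- (a + 1)); rewrite /window_sum sumrB => -> //; last by lia.
by rewrite sumr_const card_ord; lia.
Qed.

(** The sign of [a] is the indicator of [0 <= a] minus that of [a <= 0], and each indicator counts
    translates up to a floor. *)
Lemma window_sum_sg t : `|t| <= K%:Z ->
  window_sum (fun m => Num.sg (t + m * N)) = (t %/ N)%Z - (- t %/ N)%Z.
Proof.
have small a : `|a| <= K%:Z -> - (K%:Z + 1) <= (a %/ N)%Z <= K%:Z.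
  have := divz_eq a N; have := ltz_pmod a N_gt0; have := modz_ge0 a (lt0r_neq0 N_gt0).
  by move: N_gt0; clear; nia.
move=> tK; have -> : window_sum (fun m => Num.sg (t + m * N)) =
  window_sum (fun m => (0 <= (t %/ N)%Z + m)%R%:Z - (m <= (- t %/ N)%Z)%R%:Z).
  apply: eq_bigr => i _; move: (_ - _) => m.
  have dv a (l : int) : ((a + l * N) %/ N)%Z = (a %/ N)%Z + l.
    by rewrite addrC divzMDl ?gt_eqF // addrC.
  have -> : (0 <= (t %/ N)%Z + m) = (0 <= t + m * N).
    by rewrite -dv divz_ge0.
  have -> : (m <= (- t %/ N)%Z) = (t + m * N <= 0).
    by rewrite -subr_ge0 -dv divz_ge0 // mulNr -opprD oppr_ge0.
  by case: sgrP => ?; lia.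
rewrite /window_sum sumrB.
have := window_sum_geq (small t tK); rewrite /window_sum => ->.
have := @window_sum_leq (- t %/ N)%Z; rewrite /window_sum => ->.
  by clear; lia.
by apply: small; rewrite normrN.
Qed.

Lemma window_sum_point (c q k : int) (g : int -> int) :
  q = c + k * N -> `|k| <= K%:Z ->
  window_sum (fun m => if c + m * N == q then g m else 0) = g k.
Proof.
move=> -> kK; have kK' : (absz (k + K%:Z)%R < K.*2.+1)%N by lia.
rewrite /window_sum (bigD1 (Ordinal kK')) //= big1 ?addr0.
  have -> : (absz (k + K%:Z)%R)%:Z - K%:Z = k by lia.
  by rewrite eqxx.
move=> i; rewrite -val_eqE /= => ik.
rewrite (inj_eq (addrI _)) (inj_eq (mulIf _)) ?(gt_eqF N_gt0) //.
by case: eqP => // ?; lia.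
Qed.

Lemma window_sum_none (c q : int) (g : int -> int) : ~~ (N %| q - c)%Z ->
  window_sum (fun m => if c + m * N == q then g m else 0) = 0.
Proof.
move=> nd; rewrite /window_sum big1 // => i _; case: eqP => // E.
by move: nd; rewrite -E addrAC subrr add0r dvdz_mull.
Qed.

End Window.

Lemma divz_opp N t : 0 < N -> ~~ (N %| t)%Z -> (- t %/ N)%Z = - (t %/ N)%Z - 1.
Proof.
move=> N0 nd; rewrite {1}(divz_eq t N).
have -> : - ((t %/ N)%Z * N + (t %% N)%Z) =
    (- (t %/ N)%Z - 1) * N + (N - (t %% N)%Z) by ring.
rewrite divzMDl ?(gt_eqF N0) // [((N - _) %/ N)%Z]divz_small ?addr0 //.
have := ltz_pmod t N0; have := modz_ge0 t (lt0r_neq0 N0).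
have : (t %% N)%Z != 0 by apply: contra nd => /eqP/dvdz_mod0P.
by move: (t %% N)%Z N0; clear; lia.
Qed.

Section Omega.
Variables (N : int) (u : int -> bool).
Hypotheses (N_gt0 : 0 < N) (u_per : periodic N u).

Local Notation sh := (shift_edge N).

(* The number of integers in the interval ]x.1, x.2] congruent to [a], counted
   negatively if [x.2 < x.1]. *)
Definition coord x a : int := ((x.2 - a) %/ N)%Z - ((x.1 - a) %/ N)%Z.

Definition label_sign a : int := if u a then 1 else -1.

(* The form given by the exchange matrix; summed around the cycle, it telescopes
   to contributions of the four end points. *)
Definition omega x y : int :=
  label_sign x.2 * coord y x.2 - label_sign x.1 * coord y x.1
  - label_sign y.2 * coord x y.2 + label_sign y.1 * coord x y.1.

Lemma omega_anti x y : omega y x = - omega x y.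
Proof. by rewrite /omega; ring. Qed.

Lemma divz_shift a k : ((a + k * N) %/ N)%Z = (a %/ N)%Z + k.
Proof. by rewrite addrC divzMDl ?gt_eqF // addrC. Qed.

Lemma coord_shift k x a : coord (sh k x) a = coord x a.
Proof. by rewrite /coord /= ![_ + _ - a]addrAC !divz_shift; ring. Qed.

Lemma coord_periodic k x a : coord x (a + k * N) = coord x a.
Proof.
rewrite /coord; have E b : b - (a + k * N) = b - a + - k * N by ring.
by rewrite !E !divz_shift; ring.
Qed.

Lemma coord_rev x a : coord (rev_edge x) a = - coord x a.
Proof. by rewrite /coord /=; ring. Qed.

Lemma omega_rev x y : omega (rev_edge x) y = - omega x y.
Proof. by rewrite /omega !coord_rev /=; ring. Qed.

(* Two end points with different labels contribute, in addition to their local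
   terms, a difference of functions of each of them, and these cancel. *)
Lemma omega_sum x y (K : nat) :
  [/\ `|y.2 - x.2| <= K%:Z, `|y.1 - x.2| <= K%:Z, `|y.2 - x.1| <= K%:Z
    & `|y.1 - x.1| <= K%:Z] ->
  omega x y = window_sum K (fun m => local_form <%O u x (sh m y)).
Proof.
pose W a b : int := if u a == u b then
  label_sign a * (((b - a) %/ N)%Z - ((- (b - a)) %/ N)%Z) else 0.
have WE a b : `|b - a| <= K%:Z ->
    window_sum K (fun m => sign_at <%O u a (b + m * N)) = W a b.
  move=> bK; rewrite /W /sign_at /window_sum.
  under eq_bigr do rewrite (periodicM _ _ u_per).
  case: eqP => uab; last by rewrite big1.
  rewrite -(window_sum_sg N_gt0 bK) /window_sum mulr_sumr; apply: eq_bigr => i _.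
  rewrite /label_sign addrAC; move: (b + _) => c; case: (u a).
    by case: (ltgtP a c) => [ac|ca|->]; [rewrite gtr0_sg ?subr_gt0
      | rewrite ltr0_sg ?subr_lt0 | rewrite subrr sgr0].
  by case: (ltgtP a c) => [ac|ca|->]; [rewrite gtr0_sg ?subr_gt0
    | rewrite ltr0_sg ?subr_lt0 | rewrite subrr sgr0].
case=> h1 h2 h3 h4.
transitivity (W x.2 y.2 - W x.2 y.1 - W x.1 y.2 + W x.1 y.1); last first.
  by rewrite -!WE // /window_sum -!sumrB -big_split.
pose h a : int := (u a)%:Z.
have P a b : label_sign a * ((b - a) %/ N)%Z - label_sign b * ((a - b) %/ N)%Z =
    W a b + h b - h a.
  rewrite /W /h /label_sign opprB; case: eqVneq => uab.
    by rewrite uab addrK mulrBr.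
  have nd : ~~ (N %| b - a)%Z.
    apply: contra uab => /dvdzP[k E].
    by rewrite -(periodicM k a u_per) -E addrC subrK.
  by rewrite -(opprB b a) divz_opp //; move: uab; case: (u a); case: (u b) => // _;
    move: (_ %/ _)%Z => f /=; clear; lia.
have E a b : label_sign a * ((b - a) %/ N)%Z =
    W a b + h b - h a + label_sign b * ((a - b) %/ N)%Z by rewrite -P subrK.
rewrite /omega /coord !mulrBr (E x.2 y.2) (E x.2 y.1) (E x.1 y.2) (E x.1 y.1).
by ring.
Qed.

End Omega.

Section Count.
Variables (I : eqType) (N : int) (u : int -> bool) (e : I -> edge) (k : I).
Hypotheses (N_gt0 : 0 < N) (u_per : periodic N u).
Hypotheses (e_seed : noncrossing_seed N u e) (k_pos : (e k).1 < (e k).2).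
Let z := e k.
Local Notation sh := (shift_edge N).
Local Notation count j := (slide_count N u e k j).

Lemma coord_slide j a :
  coord N (slide N u z (e j)) a = coord N (e j) a + (count j)%:Z * coord N z a.
Proof.
rewrite /slide slide_headE /slide_count PoszD mulrDl.
have tailE x : coord N (slide_tail N u z x) a =
    coord N x a + (slides_tail N u z x)%:Z * coord N z a.
  rewrite /slide_tail; case: ifP => [/andP[/dvdzP[l E] _]|_]; last first.
    by rewrite mul0r addr0.
  have x1 : x.1 = z.2 + l * N by rewrite -E addrC subrK.
  rewrite mul1r /coord /= x1.
  have -> : z.2 + l * N - (z.2 - z.1) - a = z.1 - a + l * N by ring.
  have -> : z.2 + l * N - a = z.2 - a + l * N by ring.
  by rewrite !divz_shift //; ring.
rewrite -/z [in RHS]addrA -tailE; move: (slide_tail _ _ _ _) => x.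
case: ifP => [/andP[/dvdzP[l E] _]|_]; last by rewrite mul0r addr0.
have x2 : x.2 = z.1 + l * N by rewrite -E addrC subrK.
rewrite mul1r /coord /= x2.
have -> : z.1 + l * N + (z.2 - z.1) - a = z.2 - a + l * N by ring.
have -> : z.1 + l * N - a = z.1 - a + l * N by ring.
by rewrite !divz_shift //; ring.
Qed.

Lemma omega_slide j y :
  omega N u (slide N u z (e j)) y = omega N u (e j) y + (count j)%:Z * omega N u z y.
Proof.
have lper b l : label_sign u (b + l * N) = label_sign u b.
  by rewrite /label_sign (periodicM _ _ u_per).
rewrite {1 2}/omega !coord_slide.
have -> : label_sign u (slide N u z (e j)).2 * coord N y (slide N u z (e j)).2 -
   label_sign u (slide N u z (e j)).1 * coord N y (slide N u z (e j)).1 =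
   label_sign u (e j).2 * coord N y (e j).2 -
   label_sign u (e j).1 * coord N y (e j).1 +
   (count j)%:Z * (label_sign u z.2 * coord N y z.2 - label_sign u z.1 * coord N y z.1).
  rewrite /slide slide_headE /slide_count PoszD mulrDl.
  pose D x := label_sign u x.2 * coord N y x.2 - label_sign u x.1 * coord N y x.1.
  have tailE x : D (slide_tail N u z x) = D x + (slides_tail N u z x)%:Z * D z.
    rewrite /slide_tail; case: ifP => [/andP[/dvdzP[l E] _]|_]; last first.
      by rewrite mul0r addr0.
    have x1 : x.1 = z.2 + l * N by rewrite -E addrC subrK.
    rewrite mul1r /D /= x1.
    have -> : z.2 + l * N - (z.2 - z.1) = z.1 + l * N by ring.
    by rewrite !lper !coord_periodic //; ring.
  rewrite -/z [in RHS]addrA -!/(D _) -tailE; move: (slide_tail _ _ _ _) => x.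
  case: ifP => [/andP[/dvdzP[l E] _]|_]; last by rewrite mul0r addr0.
  have x2 : x.2 = z.1 + l * N by rewrite -E addrC subrK.
  rewrite mul1r /D /= x2.
  have -> : z.1 + l * N + (z.2 - z.1) = z.2 + l * N by ring.
  by rewrite !lper !coord_periodic //; ring.
by rewrite /omega; ring.
Qed.

(** By [local_formP] only common ends of [z] and the lifts of [e j] contribute to [omega]. A head
    meeting a tail counts 1 if it slides and -1 if not; common tails and common heads count -1. *)
Lemma pos_part_omega j : j != k -> pos_part (omega N u z (e j)) = (count j)%:Z.
Proof.
move=> jk; have [_ nd cp] := e_seed.
have zE : z = (z.1, z.2) by case: (z).
pose y := e j.
pose K := (absz (y.2 - z.2)%R + absz (y.1 - z.2)%R +
  absz (y.2 - z.1)%R + absz (y.1 - z.1)%R)%N.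
rewrite (@omega_sum N u N_gt0 u_per z y K); last by split; clear; rewrite /K; lia.
pose A m : int := if y.1 + m * N == z.2 then
  if ccw <%O u z.2 z.1 (y.2 + m * N) then 1 else -1 else 0.
pose B m : int := if y.2 + m * N == z.1 then
  if ccw <%O u z.1 z.2 (y.1 + m * N) then 1 else -1 else 0.
pose C m : int := if y.1 + m * N == z.1 then 1 else 0.
pose D m : int := if y.2 + m * N == z.2 then 1 else 0.
have -> : window_sum K (fun m => local_form <%O u z (sh m y)) =
    window_sum K A + window_sum K B - window_sum K C - window_sum K D.
  rewrite /window_sum -big_split -!sumrB; apply: eq_bigr => i _ /=.
  move: (_ - _) => m.
  have := @local_formP u z.1 z.2 z.1 (sh m y).1 (sh m y).2.
  rewrite /four_points_lt k_pos eqxx => /(_ isT)/implyP.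
  rewrite -!surjective_pairing compatibleC cp ?(eq_sym k) ?jk // => /(_ isT)/eqP ->.
  by congr (_ - _ - _); rewrite ?/C ?/D; case: (_ == _ :> int).
have kK l a b : (absz (a - b)%R <= K)%N -> a - b = l * N -> `|- l| <= K%:Z.
  by move: N_gt0; clear; move=> N0 h E; nia.
have pt c q l (g : int -> int) : c - q = l * N -> (absz (c - q)%R <= K)%N ->
    window_sum K (fun m => if c + m * N == q then g m else 0) = g (- l).
  move=> E h; apply: window_sum_point => //; last exact: kK E.
  by rewrite mulNr -E; ring.
have none c q (g : int -> int) : ~~ (N %| c - q)%Z ->
    window_sum K (fun m => if c + m * N == q then g m else 0) = 0.
  by move=> h; apply: window_sum_none; rewrite -opprB rpredN.
have z_ndvd := nd k; have y_ndvd := nd j; rewrite -/z -/y in z_ndvd y_ndvd.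
have k1 : (absz (y.1 - z.2)%R <= K)%N by rewrite /K; clear; lia.
have k2 : (absz (y.2 - z.1)%R <= K)%N by rewrite /K; clear; lia.
have k3 : (absz (y.1 - z.1)%R <= K)%N by rewrite /K; clear; lia.
have k4 : (absz (y.2 - z.2)%R <= K)%N by rewrite /K; clear; lia.
have tE l : y.1 - z.2 = l * N -> ccw <%O u z.2 z.1 (y.2 + - l * N) =
    ccw <%O u y.1 (y.1 - (z.2 - z.1)) y.2.
  move=> E; rewrite -[LHS](ccw_shift u_per l) mulNr subrK -E.
  by congr (ccw _ _ _ _); ring.
have hE l : y.2 - z.1 = l * N -> ccw <%O u z.1 z.2 (y.1 + - l * N) =
    ccw <%O u y.2 (y.2 + (z.2 - z.1)) y.1.
  move=> E; rewrite -[LHS](ccw_shift u_per l) mulNr subrK -E.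
  by congr (ccw _ _ _ _); ring.
(* A tail of [y] over the head of [z] excludes common tails and common heads, since neither arc is
   closed. *)
have [d1|d1] := boolP (N %| y.1 - z.2)%Z.
  have nC : ~~ (N %| y.1 - z.1)%Z.
    by apply: contra z_ndvd => d; apply: dvdz_sub_trans d1 d.
  have nD : ~~ (N %| y.2 - z.2)%Z.
    apply: contra y_ndvd => d; rewrite -opprB rpredN.
    have -> : y.1 - y.2 = y.1 - z.2 - (y.2 - z.2) by ring.
    exact: rpredB.
  rewrite [window_sum K C]none // [window_sum K D]none // !subr0.
  have /dvdzP[l1 E1] := d1.
  rewrite [window_sum K A](pt _ _ l1) // tE //.
  rewrite /slide_count.
  have [d2|d2] := boolP (N %| y.2 - z.1)%Z.
    have /dvdzP[l2 E2] := d2.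
    (* Both ends meet [z]: the two contributions have the same sign and do not cancel. *)
    have [-> hh] := slides_both N_gt0 u_per e_seed k_pos jk d1 d2.
    rewrite [window_sum K B](pt _ _ l2) // hE //.
    move: hh; rewrite /slides_head /slides_tail -/z -/y d1 d2 /= => ->.
    by case: (ccw _ _ _ _ _).
  rewrite [window_sum K B]none // addr0 /slides_head.
  have -> : (slide_tail N u z (e j)).2 = y.2 by rewrite /slide_tail; case: ifP.
  rewrite (negbTE d2) addn0 /slides_tail d1 -/y /=.
  by case: (ccw _ _ _ _ _).
have tF : slides_tail N u z (e j) = false by rewrite /slides_tail (negbTE d1).
rewrite /slide_count -/z /slide_tail tF add0n [window_sum K A]none // add0r.
have [d2|d2] := boolP (N %| y.2 - z.1)%Z.
  have nC : ~~ (N %| y.1 - z.1)%Z.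
    apply: contra y_ndvd => d.
    have -> : y.2 - y.1 = y.2 - z.1 - (y.1 - z.1) by ring.
    exact: rpredB.
  have nD : ~~ (N %| y.2 - z.2)%Z.
    by apply: contra z_ndvd => d; apply: dvdz_sub_trans d d2.
  rewrite [window_sum K C]none // [window_sum K D]none // !subr0.
  have /dvdzP[l2 E2] := d2.
  rewrite [window_sum K B](pt _ _ l2) // hE // /slides_head -/z -/y d2 /=.
  by case: (ccw _ _ _ _ _).
(* Nothing slides, and the remaining contributions are nonpositive: both sides are 0. *)
rewrite [window_sum K B]none // /slides_head -/z -/y (negbTE d2) /=.
have ge0 F : (forall m, 0 <= F m) -> 0 <= window_sum K F.
  by move=> F0; apply: sumr_ge0.
have C0 : 0 <= window_sum K C by apply: ge0 => m; rewrite /C; case: ifP.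
have D0 : 0 <= window_sum K D by apply: ge0 => m; rewrite /D; case: ifP.
by rewrite /pos_part; apply/max_idPr; move: C0 D0; clear; lia.
Qed.

End Count.

Lemma pos_partN (a : int) : pos_part (- a) = pos_part a - a.
Proof. by rewrite /pos_part; case: (leP a 0); case: (leP (- a) 0); lia. Qed.

(** Negation exchanges the two correction terms of the mutation rule. This serves for negative arcs
    and for the opposite quiver. *)
Lemma mutateN (m : nat) (k : 'I_m) (M : 'M[int]_(m + m, m)) :
  mutate k (- M) = - mutate k M.
Proof.
apply/matrixP => i j; rewrite !mxE; case: ifP => // _.
by rewrite !opprK !pos_partN; ring.
Qed.

(** * Matrix mutation realized by arcs *)

Section Realization.
Variables (m : nat) (N : int).
Hypothesis N_gt0 : 0 < N.
Implicit Types (M : 'M[int]_(m + m, m)) (e : 'I_m -> edge).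

Definition realizes u M e : Prop :=
  (forall i j, M (lshift m i) j = omega N u (e i) (e j)) /\
  (forall i j, M (rshift m i) j = coord N (e j) i%:Z).

(** As [e k] is positive, its coordinates are nonnegative, so matrix mutation adds
    [pos_part (omega N u z (e j))] copies of it to the [j]-th column; this is the number of ends
    that slide. *)
Lemma realizes_mutate_pos u M e k : periodic N u -> noncrossing_seed N u e ->
  (e k).1 < (e k).2 -> realizes u M e ->
  realizes u (mutate k M) (mutate_edges N u k e).
Proof.
move=> u_per e_seed k_pos [Mu Ml].
pose z := e k; pose cnt j := (slide_count N u e k j)%:Z.
have pcnt j : j != k -> pos_part (omega N u z (e j)) = cnt j.
  by move=> jk; exact: pos_part_omega.
have ozz x : omega N u x x = 0 by have := omega_anti N u x x; clear; lia.
have omS x j : omega N u x (slide N u z (e j)) =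
    omega N u x (e j) + cnt j * omega N u x z.
  rewrite omega_anti omega_slide // (omega_anti _ _ x (e j)) (omega_anti _ _ x z).
  by ring.
have omR x : omega N u x (rev_edge z) = - omega N u x z.
  by rewrite omega_anti omega_rev (omega_anti _ _ x z) opprK.
split=> i j; rewrite mxE /mutate_edges.
  have lE : (lshift m i == lshift m k) = (i == k) by rewrite (inj_eq (@lshift_inj _ _)).
  rewrite lE !Mu -/z; have [->|ik] := eqVneq i k; have [->|jk] := eqVneq j k => /=.
  - by rewrite omega_rev omR opprK ozz oppr0.
  - by rewrite omega_rev omS ozz mulr0 addr0.
  - by rewrite omR omega_slide // ozz mulr0 addr0.
  rewrite omega_slide // !omS ozz mulr0 addr0 (omega_anti _ _ z (e i)) opprK.
  by rewrite !pos_partN !pcnt //; ring.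
have -> : (rshift m i == lshift m k) = false by rewrite eq_sym eq_lrshift.
rewrite !Ml -/z /=; have [->|jk] := eqVneq j k; first by rewrite coord_rev.
rewrite !Mu -/z pos_partN pcnt // coord_slide //.
have -> : pos_part (coord N z i%:Z) = coord N z i%:Z.
  apply/max_idPl; rewrite /coord subr_ge0; apply: lez_pdiv2r; first exact: ltW.
  by rewrite lerD2r ltW.
by rewrite subrr mul0r subr0 mulrC.
Qed.

Lemma realizes_rev u M e : realizes u M e ->
  realizes (negb \o u) (- M) (fun j => rev_edge (e j)).
Proof.
case=> Mu Ml; split=> i j; rewrite mxE ?Mu ?Ml; last by rewrite coord_rev.
rewrite /omega !coord_rev /label_sign /=.
by do 4 case: (u _); rewrite /=; ring.
Qed.

(** A negative arc becomes positive once the sides are exchanged and all arcs reversed, which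
    negates the matrix. *)
Lemma realizes_mutate u M e k : periodic N u -> noncrossing_seed N u e ->
  realizes u M e ->
  exists e', noncrossing_seed N u e' /\ realizes u (mutate k M) e'.
Proof.
move=> u_per e_seed Me; have [_ nd _] := e_seed.
have [k_pos|k_neg|kE] := ltgtP (e k).1 (e k).2.
- exists (mutate_edges N u k e).
  by split; [exact: mutate_noncrossing_seed | exact: realizes_mutate_pos].
- have uNN : negb \o (negb \o u) = u by apply/funext => a /=; rewrite negbK.
  have uN_per : periodic N (negb \o u) by move=> a /=; rewrite u_per.
  have eN_seed := noncrossing_seed_rev e_seed.
  have := mutate_noncrossing_seed N_gt0 uN_per eN_seed k_neg.
  move=> /noncrossing_seed_rev; rewrite uNN => e'_seed.
  have := realizes_mutate_pos uN_per eN_seed k_neg (realizes_rev Me).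
  move=> /realizes_rev; rewrite uNN mutateN opprK => Me'.
  by eexists; split; eassumption.
- by have := nd k; rewrite kE subrr dvdz0.
Qed.

End Realization.

(** * The initial seed *)

Lemma coord_simple N b a : 0 < N -> coord N (b - 1, b) a = (N %| b - a)%Z%:Z.
Proof.
move=> N0; rewrite /coord /= -addrA [- 1 - a]addrC addrA; move: (b - a) => t {b a}.
have [/dvdzP[k ->]|nd] := boolP (N %| t)%Z.
  rewrite mulzK ?gt_eqF //.
  have -> : k * N - 1 = (k - 1) * N + (N - 1) by ring.
  by rewrite divzMDl ?gt_eqF // divz_small ?addr0; lia.
have := divz_eq t N; have := ltz_pmod t N0; have := modz_ge0 t (lt0r_neq0 N0).
have : (t %% N)%Z != 0 by apply: contra nd => /eqP/dvdz_mod0P.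
move: (t %/ N)%Z (t %% N)%Z => k r r0 r1 rN ->.
rewrite -addrA !divzMDl ?gt_eqF // !divz_small ?subrr //; clear nd; lia.
Qed.

Section Cycle.
Variables (n : nat) (o : 'I_n.+1 -> bool).
Hypothesis n_gt0 : (0 < n)%N.
Let N : int := n.+1%:Z.

(* The point [a] is a lift of the edge of the cycle joining [a] and [a + 1]
   modulo [n.+1]. *)
Definition label (a : int) : bool := o (inord (absz (a %% n.+1%:Z)%Z)).

Lemma label_periodic : periodic N label.
Proof. by move=> a; rewrite /label modzDr. Qed.

Lemma label_ord (i : 'I_n.+1) : label i%:Z = o i.
Proof.
rewrite /label modz_nat absz_nat modn_small //.
by congr (o _); apply/val_inj; rewrite /= inordK.
Qed.

Lemma dvdz_ord (i j : 'I_n.+1) : (N %| j%:Z - i%:Z)%Z = (i == j).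
Proof.
by rewrite -eqz_mod_dvd !modz_nat !modn_small // eqz_nat eq_sym.
Qed.

Lemma dvdz_ordS (i j : 'I_n.+1) : (N %| j%:Z - (i%:Z - 1))%Z = (i == ordS j).
Proof.
have -> : j%:Z - (i%:Z - 1) = j.+1%:Z - i%:Z by rewrite intS; ring.
by rewrite -eqz_mod_dvd !modz_nat [X in _ == X%:Z]modn_small // eqz_nat eq_sym.
Qed.

Lemma label_pred (j : 'I_n.+1) : label ((ordS j)%:Z - 1) = o j.
Proof.
have /dvdzP[k E] : (N %| j%:Z - ((ordS j)%:Z - 1))%Z by rewrite dvdz_ordS.
by rewrite -label_ord -(periodicM k _ label_periodic) -E addrC subrK.
Qed.

Lemma cycle_quiverE i j :
  cycle_quiver o i j = ((o i && (j == ordS i)) + (~~ o j && (i == ordS j)))%N.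
Proof.
rewrite mxE -sum1dep_card big_mkcond /= (bigID o) /=; congr (_ + _)%N.
  rewrite (eq_bigr (fun k => if (i == k) && (j == ordS k) then 1 else 0)%N); last first.
    by move=> k ->.
  case oi: (o i); last first.
    rewrite big1 // => k ok; case: (eqVneq i k) => // ik.
    by rewrite -ik oi in ok.
  rewrite (bigD1 i) ?oi //= eqxx big1 ?addn0 //= .
  by move=> k /andP[_ ki]; rewrite eq_sym (negbTE ki).
rewrite (eq_bigr (fun k => if (i == ordS k) && (j == k) then 1 else 0)%N); last first.
  by move=> k /negbTE ->.
case oj: (o j).
  rewrite big1 // => k ok; case: (eqVneq j k) => // [jk|]; last by rewrite andbF.
  by rewrite -jk oj in ok.
rewrite (bigD1 j) ?oj //= eqxx andbT big1 ?addn0 //=.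
by move=> k /andP[_ ki]; rewrite [j == k]eq_sym (negbTE ki) andbF.
Qed.

(** The vertex [j] lies between the points [j - 1] and [j], so [id] gives the simple roots of the
    principal seed; another [pi] visits the points in another order. *)
Definition path_edges (pi : int -> int) (j : 'I_n.+1) : edge :=
  (pi (j%:Z - 1), pi j%:Z).

Lemma realizes_principal :
  realizes N label (principal_matrix (cycle_quiver o)) (path_edges id).
Proof.
have N0 : 0 < N by [].
split=> i j.
  rewrite col_mxEu mxE !cycle_quiverE /omega /path_edges /= !coord_simple //.
  rewrite !dvdz_ord !dvdz_ordS /label_sign !label_ord.
  have lS (k l : 'I_n.+1) : (if label (k%:Z - 1) then 1 else - 1) * (k == ordS l)%:Z =
      (if o l then 1 else - 1) * (k == ordS l)%:Z.
    by case: eqVneq => [->|]; rewrite ?label_pred ?mulr0.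
  rewrite !lS; have -> : (if o j then 1 else - 1) * (j == i)%:Z =
      (if o i then 1 else - 1) * (i == j)%:Z :> int.
    by rewrite eq_sym; case: eqVneq => [->|]; rewrite ?mulr0.
  by case: (o i); case: (o j); case: (j == ordS i); case: (i == ordS j);
    case: (i == j).
rewrite col_mxEd mxE coord_simple // dvdz_ord.
by case: (i == j).
Qed.

Lemma separated_compatible u a b : a != b -> compatible <%O u (a - 1, a) (b - 1, b).
Proof.
wlog ab : a b / a < b => [th|_].
  case: ltgtP => // ab _; first by apply: th; rewrite ?lt_eqF.
  by rewrite compatibleC; apply: th; rewrite ?lt_eqF.
have := @separatedP u (a - 1) a (a - 1) (b - 1) b.
rewrite /four_points_lt eqxx ltrBlDr ltrDl ltr01 => /(_ isT)/implyP.
rewrite ltrBlDr ltrDl ltr01 => /(_ isT)/implyP; apply.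
by move: ab; clear; lia.
Qed.

Lemma path_edges_id_seed : (exists v, label (v - 1) != label v) ->
  noncrossing_seed N label (path_edges id).
Proof.
move=> [v lv]; split.
- have N0 : N != 0 by [].
  have rN : (absz (v %% N)%Z < n.+1)%N.
    by rewrite -ltz_nat gez0_abs ?modz_ge0 // ltz_pmod.
  exists (inord (absz (v %% N)%Z)); rewrite /path_edges /= inordK //.
  rewrite gez0_abs ?modz_ge0 //; move: lv; rewrite {1 2}(divz_eq v N).
  rewrite -addrA addrC [(v %/ N)%Z * N + _]addrC.
  by rewrite !(periodicM _ _ label_periodic).
- move=> j; rewrite /path_edges /= opprB addrC subrK dvdz1.
  by rewrite /N absz_nat eqSS -lt0n.
move=> i j k ijk; rewrite /path_edges /shift_edge /=.
rewrite addrAC; apply: separated_compatible.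
case/orP: ijk => [ij|k0]; apply: contraTneq isT => E.
  have := dvdz_ord j i; rewrite E addrAC subrr add0r dvdz_mull // => /esym/eqP ji.
  by rewrite ji eqxx in ij.
have d : (N %| i%:Z - j%:Z)%Z by rewrite E addrAC subrr add0r dvdz_mull.
rewrite dvdz_ord in d; move: E; rewrite (eqP d) => /eqP.
by rewrite -subr_eq0 opprD addrA subrr add0r oppr_eq0 mulf_eq0 (negbTE k0).
Qed.

End Cycle.

Lemma mutated_matrix_rcons m (Q : quiver m) ks k :
  mutated_matrix Q (rcons ks k) = mutate k (mutated_matrix Q ks).
Proof. by rewrite /mutated_matrix foldl_rcons. Qed.

Lemma ccw_after_tail u p q r : ~~ u p -> u q -> (if u r then q < r else p < r) ->
  ccw <%O u q p r.
Proof.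
by rewrite /ccw /circle_lt => /negbTE -> ->; case: (u r) => /= ->; rewrite ?orbT.
Qed.

Lemma ccw_after_head u p q r : ~~ u p -> u q -> (if u r then r < q else r < p) ->
  ccw <%O u p q r.
Proof.
by rewrite /ccw /circle_lt => /negbTE -> ->; case: (u r) => /= ->; rewrite ?orbT.
Qed.

(** * The exclusion process *)

Section Swap.
Variable N : int.
Hypothesis N_gt1 : 1 < N.

(* The permutation exchanging [k - 1] and [k], periodically. *)
Definition swap_pos (k i : int) : int :=
  if (N %| i - k)%Z then i - 1 else if (N %| i + 1 - k)%Z then i + 1 else i.

Lemma dvdz_gap (a : int) : (N %| a)%Z -> ~~ (N %| a + 1)%Z.
Proof.
move=> d; rewrite rpredDl // dvdz1; move: N_gt1; clear; lia.
Qed.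

Variant swap_spec k i : int -> Prop :=
| SwapDown of (N %| i - k)%Z & ~~ (N %| i + 1 - k)%Z : swap_spec k i (i - 1)
| SwapUp of (N %| i + 1 - k)%Z & ~~ (N %| i - k)%Z : swap_spec k i (i + 1)
| SwapStay of ~~ (N %| i - k)%Z & ~~ (N %| i + 1 - k)%Z : swap_spec k i i.

Lemma swapP k i : swap_spec k i (swap_pos k i).
Proof.
rewrite /swap_pos; case: ifP => d1.
  by apply: SwapDown => //; rewrite addrAC dvdz_gap.
by case: ifP => d2; [apply: SwapUp | apply: SwapStay] => //; rewrite ?d1 ?d2.
Qed.

Lemma swap_posK k : involutive (swap_pos k).
Proof.
move=> i; case: (swapP k i) => [d1 d2|d1 d2|d1 d2]; rewrite /swap_pos.
- rewrite subrK d1.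
  have -> : i - 1 - k = i - k - 1 by clear; lia.
  by rewrite rpredBl // dvdz1 ifN //; move: N_gt1; clear; lia.
- by rewrite d1 addrK.
- by rewrite (negbTE d1) (negbTE d2).
Qed.

Lemma swap_pos_shift k l i : swap_pos k (i + l * N) = swap_pos k i + l * N.
Proof.
have D a : (N %| a + l * N)%Z = (N %| a)%Z by rewrite rpredDr ?dvdz_mull.
have E a : i + l * N + a = i + a + l * N by rewrite addrAC.
rewrite /swap_pos [i + _ + 1]E ![_ + l * N - k]addrAC !D.
by case: ifP => _; [|case: ifP => _]; rewrite // addrAC.
Qed.

Lemma swap_pos_lt k i j : i < j -> swap_pos k j < swap_pos k i ->
  (N %| j - k)%Z && (j == i + 1).
Proof.
move=> ij; have nE : swap_pos k j != swap_pos k i.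
  by rewrite (inj_eq (can_inj (swap_posK k))) gt_eqF.
move: nE ij; case: (swapP k i) => [_ _|_ _|_ _];
  by case: (swapP k j) => [-> _|_ _|_ _]; clear; lia.
Qed.

End Swap.

Section Reach.
Variables (n : nat) (o : 'I_n.+1 -> bool).
Hypothesis n_gt0 : (0 < n)%N.
Let N : int := n.+1%:Z.
Local Notation lab := (label o).
Let Q := cycle_quiver o.

Definition edge_vector x : 'cV[int]_n.+1 := \col_v coord n.+1%:Z x v%:Z.

(* The paths of the exclusion process: the only inversions come from an upper
   and a lower point that have met. *)
Definition reachable_path (pi : int -> int) : Prop :=
  [/\ noncrossing_seed N lab (@path_edges n pi),
      exists ks, realizes N lab (mutated_matrix Q ks) (@path_edges n pi),
      (forall i, pi (i + N) = pi i + N) /\ injective pi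
    & forall i j, i < j -> ~~ (lab (pi i) && ~~ lab (pi j)) -> pi i < pi j].

Let N_gt1 : 1 < N. Proof. by []. Qed.
Let N_gt0 : 0 < N. Proof. by []. Qed.

Lemma path_shift (pi : int -> int) (l i : int) :
  (forall i, pi (i + N) = pi i + N) -> pi (i + l * N) = pi i + l * N.
Proof.
move=> piN; have nat_shift (m : nat) i' : pi (i' + m%:Z * N) = pi i' + m%:Z * N.
  elim: m i' => [|m IHm] i'; first by rewrite mul0r !addr0.
  by rewrite intS mulrDl mul1r addrA IHm piN addrA.
case: (intP l) => [|m|m]; first by rewrite mul0r !addr0.
  exact: nat_shift.
by apply: (addIr (m.+1%:Z * N)); rewrite -nat_shift mulNr !subrK.
Qed.

Lemma path_dvdz (pi : int -> int) i j :
  (forall i, pi (i + N) = pi i + N) -> injective pi ->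
  (N %| pi i - pi j)%Z = (N %| i - j)%Z.
Proof.
move=> piN pi_inj; apply/idP/idP => /dvdzP[l E]; apply/dvdzP; exists l.
  have : pi i = pi (j + l * N) by rewrite path_shift // -E addrC subrK.
  by move/pi_inj => ->; rewrite addrAC subrr add0r.
have -> : i = j + l * N by rewrite -E addrC subrK.
by rewrite path_shift // addrAC subrr add0r.
Qed.

Lemma label_path_shift (pi : int -> int) (l i : int) :
  (forall i, pi (i + N) = pi i + N) -> lab (pi (i + l * N)) = lab (pi i).
Proof. by move=> piN; rewrite path_shift // (periodicM _ _ (label_periodic o)). Qed.

Lemma reduce_mod (k : int) : exists (kk : 'I_n.+1) (l : int), k = kk%:Z + l * N.
Proof.
have rN : (absz (k %% N)%Z < n.+1)%N.
  by rewrite -ltz_nat gez0_abs ?modz_ge0 // ltz_pmod.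
exists (Ordinal rN), (k %/ N)%Z.
by rewrite /= gez0_abs ?modz_ge0 // addrC -divz_eq.
Qed.

(** The arc from the lower point [pi (k - 1)] to the upper point [pi k] is positive. Mutating at it
    slides the head of the preceding arc and the tail of the following one, which exchanges the two
    points along the path. The new inversion has its upper point first, as the invariant allows. *)
Lemma swap_reachable_ord pi (kk : 'I_n.+1) (k := kk%:Z) : reachable_path pi ->
  ~~ lab (pi (k - 1)) -> lab (pi k) -> reachable_path (pi \o swap_pos N k).
Proof.
case=> pi_seed [ks Mpi] [piN pi_inj] pi_lt lp lq.
have u_per := label_periodic o.
have pdv i j : (N %| pi i - pi j)%Z = (N %| i - j)%Z by exact: path_dvdz.
pose p := pi (k - 1); pose q := pi k.
have pq : p < q.
  by apply: pi_lt; [clear; lia | rewrite (negbTE lp)].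
have ekE : path_edges pi kk = (p, q) by [].
have edgesE : mutate_edges N lab kk (path_edges pi) = path_edges (pi \o swap_pos N k).
  apply/funext => j; rewrite /mutate_edges.
  have [->|jk] := eqVneq j kk.
    rewrite /path_edges /rev_edge /= -/k.
    have -> : swap_pos N k (k - 1) = k.
      rewrite /swap_pos subrK subrr dvdz0 addrAC subrr add0r rpredN dvdz1 ifN //.
      by rewrite -lt0n.
    by rewrite /swap_pos subrr dvdz0.
  have njk : ~~ (N %| j%:Z - k)%Z by rewrite dvdz_ord eq_sym.
  rewrite /slide slide_headE ekE.
  have tE : slide_tail N lab (p, q) (path_edges pi j) =
      ((pi \o swap_pos N k) (j%:Z - 1), pi j).
    rewrite /slide_tail /slides_tail /= pdv.
    case: (swapP N_gt1 k (j%:Z - 1)) => [d _|d _|d _]; last by rewrite (negbTE d).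
      have /dvdzP[l E] := d; rewrite d /=.
      have j1E : j%:Z - 1 = k + l * N by rewrite -E [RHS]addrC subrK.
      have jE : j%:Z = k + 1 + l * N by move: j1E; clear; lia.
      have -> : j%:Z - 1 - 1 = k - 1 + l * N by rewrite j1E addrAC.
      rewrite j1E jE !path_shift // -/p -/q.
      have -> : q + l * N - (q - p) = p + l * N by clear; lia.
      (* The invariant gives [q < r] if the next point [r] is upper and [p < r] if it is lower, so
         the tail slides. *)
      rewrite ccw_shift // ccw_after_tail //.
      by case: ifP => lr; apply: pi_lt; rewrite ?(negbTE lp) ?lr ?andbF //;
        clear; lia.
    have E : j%:Z - 1 + 1 - k = j%:Z - k by clear; lia.
    by rewrite E (negbTE njk) in d.
  rewrite tE /slides_head /= pdv.
  have -> : j%:Z - (k - 1) = j%:Z + 1 - k by clear; lia.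
  rewrite [path_edges _ _]surjective_pairing /=.
  case: (swapP N_gt1 k j%:Z) => [d|d _|_ d]; first by rewrite d in njk.
    have /dvdzP[l E] := d; rewrite d /=.
    have jE : j%:Z = k - 1 + l * N by move: E; clear; lia.
    have -> : j%:Z + 1 = k + l * N by rewrite -E; clear; lia.
    rewrite jE !path_shift // -/p -/q.
    have -> : p + l * N + (q - p) = q + l * N by clear; lia.
    have -> : k - 1 + l * N - 1 = k - 2 + l * N by clear; lia.
    rewrite swap_pos_shift // path_shift // ccw_shift // ccw_after_head //.
    (* For [N = 2] the position [k - 2] is congruent to [k], and the tail there has already slid. *)
    case: (swapP N_gt1 k (k - 2)) => [d2 _|d2 _|_ _].
    + have /dvdzP[l2 E2] := d2.
      have -> : k - 2 - 1 = k - 1 + l2 * N by rewrite -E2; clear; lia.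
      rewrite label_path_shift // (negbTE lp) path_shift //.
      by rewrite -E2 -/p; clear; lia.
    + by exfalso; move: d2; rewrite (_ : _ - k = - 1) ?rpredN ?dvdz1 ?absz_nat //=;
        [case: (n) n_gt0 | clear; lia].
    + by case: ifP => lr; apply: pi_lt; rewrite ?lq ?lr ?andbF //;
        clear; lia.
  by rewrite (negbTE d).
split.
- rewrite -edgesE; apply: mutate_noncrossing_seed => //.
- exists (rcons ks kk); rewrite mutated_matrix_rcons -edgesE.
  by apply: realizes_mutate_pos.
- split=> [i|]; first by have := swap_pos_shift N k 1 i; rewrite /= !mul1r => ->.
  exact: inj_comp pi_inj (can_inj (swap_posK N_gt1 k)).
move=> i j ij /= nl; apply: (pi_lt) => //.
rewrite ltNge le_eqVlt negb_or (inj_eq (can_inj (swap_posK N_gt1 k))) gt_eqF //=.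
apply/negP => /(swap_pos_lt N_gt1 ij)/andP[/dvdzP[l E] /eqP jE].
move: nl; have jE' : j = k + l * N by rewrite -E addrC subrK.
have iE : i = k - 1 + l * N by move: jE jE'; clear; lia.
have sj : swap_pos N k j = k - 1 + l * N.
  by rewrite /swap_pos E dvdz_mull // -iE jE addrK.
have si : swap_pos N k i = k + l * N.
  have := swap_posK N_gt1 k j; rewrite sj -iE => ->; exact: jE'.
by rewrite si sj !label_path_shift // lq lp.
Qed.

Lemma swap_reachable pi (k : int) : reachable_path pi ->
  ~~ lab (pi (k - 1)) -> lab (pi k) -> reachable_path (pi \o swap_pos N k).
Proof.
have [kk [l kE]] := reduce_mod k; rewrite kE => pi_r.
have [_ _ [piN _] _] := pi_r.
have -> : swap_pos N (kk%:Z + l * N) = swap_pos N kk%:Z.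
  have D a : (N %| a - (kk%:Z + l * N))%Z = (N %| a - kk%:Z)%Z.
    by rewrite opprD addrA rpredDr // rpredN dvdz_mull.
  by apply/funext => i; rewrite /swap_pos !D.
rewrite addrAC !label_path_shift //.
exact: swap_reachable_ord.
Qed.

Lemma path_edge_c_vector pi (i : int) : reachable_path pi ->
  c_vectors Q (edge_vector (pi (i - 1), pi i)).
Proof.
case=> _ [ks [_ Ml]] [piN _] _; have [j [l ->]] := reduce_mod i.
exists ks, j; apply/colP => v; rewrite !mxE Ml addrAC !path_shift //.
by rewrite -[LHS](coord_shift N_gt0 (- l)) /shift_edge /= !mulNr !addrK.
Qed.

(** Strong induction on the number [d] of points strictly between the two on the path, and within it
    on the number [h] of lower points before the first upper one, which is swapped towards [pi i]. A
    swap that moves either of the two given points brings them closer. *)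
Lemma positive_edge_c_vector a b : (exists v, lab (v - 1) != lab v) ->
  a < b -> ~~ lab a -> lab b -> c_vectors Q (edge_vector (a, b)).
Proof.
move=> lab_var ab la lb.
suff main (d : nat) (pi : int -> int) i : reachable_path pi ->
    ~~ lab (pi i) -> lab (pi (i + d.+1%:Z)) ->
    c_vectors Q (edge_vector (pi i, pi (i + d.+1%:Z))).
  have id_r : reachable_path id.
    split; [exact: path_edges_id_seed | | by split=> // i j | by []].
    by exists [::]; exact: realizes_principal.
  have dE : b = a + (absz (b - a - 1)%R).+1%:Z by move: ab; clear; lia.
  by have := main (absz (b - a - 1)%R) id a id_r la; rewrite -dE => /(_ lb).
elim/ltn_ind: d pi i => d IHd pi i pi_r li lj.
have [h0 lh0] : exists h, lab (pi (i + h.+1%:Z)) by exists d.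
have [h lh hmin] := find_ex_minn (ex_intro (fun h => lab (pi (i + h.+1%:Z))) h0 lh0).
have {hmin} lmin (l : nat) : (l <= h)%N -> ~~ lab (pi (i + l%:Z)).
  case: l => [|l] lh'; first by rewrite addr0.
  by apply/negP => /hmin; rewrite leqNgt lh'.
have hd : (h <= d)%N by rewrite leqNgt; apply/negP => /lmin; rewrite lj.
clear h0 lh0.
have lab_dvdz (pi' : int -> int) (x y : int) : reachable_path pi' -> (N %| x - y)%Z ->
    lab (pi' x) = lab (pi' y).
  case=> _ _ [piN _] _ /dvdzP[l E].
  by rewrite -(label_path_shift l y) // -E [y + _]addrC subrK.
have step h' (pi' : int -> int) (k := i + h'.+1%:Z) (j := i + d.+1%:Z) :
    reachable_path pi' -> ~~ lab (pi' i) -> lab (pi' j) -> lab (pi' k) ->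
    ~~ lab (pi' (k - 1)) -> (h' <= d)%N -> d != 0%N ->
    (reachable_path (pi' \o swap_pos N k)) /\
    (swap_pos N k i = i /\ swap_pos N k j = j \/
     c_vectors Q (edge_vector (pi' i, pi' j))).
  move=> pi'_r li' lj' lk lk1 h'd d0.
  have pi''_r := swap_reachable pi'_r lk1 lk; split=> //.
  (* Being lower, the point at [i] can only move right; being upper, the one at [j] can only move
     left. *)
  have ni : ~~ (N %| i - k)%Z.
    by apply/negP => /(lab_dvdz _ _ _ pi'_r) E; rewrite E lk in li'.
  have nj : ~~ (N %| j + 1 - k)%Z.
    apply/negP; rewrite (_ : j + 1 - k = j - (k - 1)); last by clear; lia.
    by move/(lab_dvdz _ _ _ pi'_r) => E; rewrite E (negbTE lk1) in lj'.
  have sij : swap_pos N k i != swap_pos N k j.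
    by rewrite (inj_eq (can_inj (swap_posK N_gt1 k))) /j; clear; lia.
  have si : swap_pos N k i = i \/ swap_pos N k i = i + 1.
    by case: swapP => // [d1|_|_]; [rewrite d1 in ni | right | left].
  have sj : swap_pos N k j = j \/ swap_pos N k j = j - 1.
    by case: swapP => // [_|d1|_]; [right | rewrite d1 in nj | left].
  have [sE|sN] := boolP ((swap_pos N k i == i) && (swap_pos N k j == j)).
    by left; move: sE => /andP[/eqP -> /eqP ->].
  right; pose m := (absz (swap_pos N k j - swap_pos N k i)%R).-1.
  have mE : swap_pos N k j = swap_pos N k i + m.+1%:Z /\ (m < d)%N.
    by move: si sj sij sN d0; rewrite /m /j; clear; lia.
  have := IHd m mE.2 (pi' \o swap_pos N k) (swap_pos N k i) pi''_r.
  by rewrite -mE.1 /= !swap_posK //; apply.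
elim: h pi pi_r li lj lh lmin hd => [|h IHh] pi pi_r li lj lh lmin hd.
  (* The upper point is next to [i]: either it is the one at [j] and the arc belongs to the path, or
     the swap moves [i]. *)
  have [d0|d0] := eqVneq d 0%N.
    by have := path_edge_c_vector (i + 1) pi_r; rewrite addrK d0.
  have := step 0%N pi pi_r li lj lh; rewrite addrK => /(_ li hd d0)[_ []] //.
  have ndvdN1 : ~~ (N %| (- 1)%R)%Z by rewrite rpredN dvdz1 absz_nat eqSS -lt0n.
  case=> + _; rewrite /swap_pos.
  rewrite (_ : i - (i + 1%:Z) = - 1); last by clear; lia.
  rewrite (_ : i + 1 - (i + 1%:Z) = 0); last by clear; lia.
  by rewrite dvdz0 (negbTE ndvdN1); clear; lia.
have lh1 : ~~ lab (pi (i + h.+2%:Z - 1)).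
  by have := lmin h.+1 (leqnn _); congr (~~ lab (pi _)); clear; lia.
have d0 : d != 0%N by rewrite -lt0n (leq_trans _ hd).
have [pi'_r [[si sj] // |//]] := step h.+1 pi pi_r li lj lh lh1 hd d0.
set k := i + h.+2%:Z in si sj pi'_r.
have stay (l : nat) : (l <= h)%N -> swap_pos N k (i + l%:Z) = i + l%:Z.
  move=> lh'; case: swapP => // d1 _; exfalso.
    have := lmin l (leqW lh').
    by rewrite (lab_dvdz _ _ _ pi_r d1) lh.
  have := lmin l.+1 lh'; rewrite -addn1 PoszD addrA.
  by rewrite (lab_dvdz _ _ _ pi_r d1) lh.
have := IHh (pi \o swap_pos N k) pi'_r; rewrite /= si sj; apply=> //.
- rewrite /swap_pos (_ : i + h.+1%:Z - k = - 1); last by rewrite /k; clear; lia.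
  rewrite rpredN dvdz1 ifN ?absz_nat ?eqSS -?lt0n //.
  rewrite (_ : i + h.+1%:Z + 1 - k = 0); last by rewrite /k; clear; lia.
  by rewrite dvdz0 (_ : _ + 1 = k) //; rewrite /k; clear; lia.
- by move=> l lh'; rewrite /= stay // lmin // leqW.
- exact: ltnW.
Qed.

End Reach.

(** * The opposite quiver *)

Section Sinks.
Variables (m : nat) (Q : quiver m).
Hypothesis Q_acyclic : acyclic_quiver Q.
Implicit Types (D : {set 'I_m}) (i j k : 'I_m).

Definition flip D i : int := if i \in D then -1 else 1.

(** For [D] closed under arrows, this is the seed after one mutation at each vertex of [D], sinks
    first. *)
Definition flipped_matrix D : 'M[int]_(m + m, m) :=
  col_mx (\matrix_(i, j) (flip D i * flip D j * exchange_matrix Q i j))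
         (\matrix_(i, j) (flip D i * (i == j)%:Z)).

Lemma flipped_matrix0 : flipped_matrix finset.set0 = principal_matrix Q.
Proof.
rewrite /flipped_matrix /principal_matrix; congr col_mx; apply/matrixP => i j.
  by rewrite mxE /flip !inE !mul1r.
by rewrite !mxE /flip inE mul1r; case: (i == j).
Qed.

Lemma no_loop i : ~~ arrow Q i i.
Proof.
by apply/negP => ii; have := @Q_acyclic [:: i]; rewrite /= ii => /(_ isT).
Qed.

(** The row of [k] is nonpositive and its column nonnegative, so the products of positive parts
    vanish and only signs change. *)
Lemma mutate_flipped D k : k \notin D ->
  (forall j, arrow Q k j -> j \in D) -> (forall i, i \in D -> ~~ arrow Q i k) ->
  mutate k (flipped_matrix D) = flipped_matrix (k |: D).
Proof.
move=> kD kout Dk.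
have arr0 i j : ~~ arrow Q i j -> Q i j = 0%N by rewrite /arrow -eqn0Ngt => /eqP.
have Qkk := arr0 _ _ (no_loop k).
have flipS i : flip (k |: D) i = if i == k then -1 else flip D i.
  by rewrite /flip !inE; case: eqVneq.
have flk : flip D k = 1 by rewrite /flip (negbTE kD).
have rowk j : flip D k * flip D j * exchange_matrix Q k j <= 0.
  rewrite flk mul1r mxE /flip; case: ifP => jD.
    by rewrite (arr0 _ _ (Dk _ jD)); lia.
  by rewrite (arr0 k j) ?jD; [lia | apply: contraFN jD => /kout].
have colk i : 0 <= flip D i * flip D k * exchange_matrix Q i k.
  have := rowk i; rewrite !mxE; lia.
have pos0 (a : int) : a <= 0 -> pos_part a = 0 by rewrite /pos_part => /max_idPr.
have Bkk : exchange_matrix Q k k = 0 by rewrite mxE subrr.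
rewrite /flipped_matrix.
move: (exchange_matrix Q) rowk colk Bkk => B rowk colk Bkk.
apply/matrixP => i j; case: (split_ordP i) => {}i ->; rewrite [LHS]mxE.
  rewrite !col_mxEu !mxE !flipS (inj_eq (@lshift_inj _ _)).
  rewrite (pos0 _ (rowk j)) mulr0 addr0.
  rewrite (pos0 (- (flip D i * flip D k * B i k))) ?oppr_le0 // mul0r subr0.
  have [->|ik] := eqVneq i k; have [->|jk] := eqVneq j k => //=; rewrite ?flk.
  - by rewrite Bkk !mulr0 oppr0.
  - by rewrite mul1r mulN1r mulNr.
  - by rewrite mulr1 mulrN1 mulNr.
rewrite !col_mxEd !col_mxEu !mxE !flipS eq_sym eq_lrshift /=.
have [->|jk] := eqVneq j k.
  by have [->|] := eqVneq i k; rewrite ?mulr0 ?oppr0 // flk mul1r mulN1r.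
rewrite (pos0 _ (rowk j)) mulr0 addr0.
have [->|ik] := eqVneq i k; last by rewrite mulr0 oppr0 (pos0 0) // mul0r subr0.
rewrite flk mul1r (pos0 (- 1)) // mul0r subr0.
by rewrite [k == j]eq_sym (negbTE jk) !mulr0.
Qed.

(* The number of vertices reachable from a vertex decreases along the arrows. *)
Lemma exists_sink_outside D : D != finset.setT ->
  exists k, k \notin D /\ forall j, arrow Q k j -> j \in D.
Proof.
move=> DT; have [k0 k0D] : exists k, k \notin D.
  apply/existsP; apply: contraR DT => /existsPn nD; apply/eqP/setP => i.
  by rewrite inE; have := nD i; rewrite negbK.
pose r k := #|connect (arrow Q) k|.
case: (@arg_minnP _ k0 (fun k => k \notin D) r k0D) => k kD kmin.
exists k; split=> // j kj; apply/negPn/negP => jD.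
have := kmin j jD; rewrite leqNgt => /negP; apply.
apply/proper_card/properP; split.
  apply/fintype.subsetP => i; rewrite !inE; apply: connect_trans.
  exact: connect1.
exists k; first by rewrite !inE connect0.
apply/negP; rewrite inE => /connectP[p pp pl].
have := @Q_acyclic (j :: p); rewrite /= rcons_path pp -pl kj => /(_ isT).
by [].
Qed.

Lemma mutate_all_sinks : exists ks,
  mutated_matrix Q ks = flipped_matrix finset.setT.
Proof.
suff main (d : nat) D : #|~: D| = d -> (forall i j, i \in D -> arrow Q i j -> j \in D) ->
    (exists ks, mutated_matrix Q ks = flipped_matrix D) ->
    exists ks, mutated_matrix Q ks = flipped_matrix finset.setT.
  apply: (main _ finset.set0 erefl) => [i j|]; first by rewrite inE.
  by exists [::]; rewrite flipped_matrix0.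
elim: d D => [|d IHd] D cD Dcl [ks ksE].
  have -> : finset.setT = D by rewrite -[D]finset.setCK (cards0_eq cD) finset.setC0.
  by exists ks.
have DT : D != finset.setT.
  by apply: contra_eqN cD => /eqP ->; rewrite finset.setCT cards0.
have [k [kD kout]] := exists_sink_outside DT.
apply: (IHd (k |: D)).
- by move: cD; rewrite finset.setCU finset.setIC -finset.setDE (cardsD1 k) inE kD => -[].
- move=> i j; rewrite !inE => /orP[/eqP ->|iD] ij; first by rewrite kout ?orbT.
  by rewrite (Dcl i) ?orbT.
exists (rcons ks k); rewrite mutated_matrix_rcons ksE mutate_flipped //.
by move=> i iD; apply: contra kD; exact: Dcl.
Qed.

End Sinks.

Section Symmetry.
Variable m : nat.
Implicit Types (Q : quiver m) (c : 'cV[int]_m).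

(** One more mutation at [j] negates the [j]-th column. *)
Lemma c_vectorsN Q c : c_vectors Q c -> c_vectors Q (- c).
Proof.
case=> ks [j ->]; exists (rcons ks j), j; rewrite mutated_matrix_rcons.
by apply/colP => i; rewrite !mxE eqxx orbT.
Qed.

(* Once every vertex is flipped, the seed is the opposite of the principal seed
   of the opposite quiver. *)
Lemma c_vectors_opposite Q c : acyclic_quiver Q -> c_vectors Q^T c -> c_vectors Q c.
Proof.
move=> Qac [ls [j cE]]; have [ks ksE] := mutate_all_sinks Qac.
suff : c_vectors Q (- c) by move/c_vectorsN; rewrite opprK.
exists (ks ++ ls), j; rewrite cE /mutated_matrix foldl_cat -/(mutated_matrix Q ks) ksE.
have -> : flipped_matrix Q finset.setT = - principal_matrix Q^T.
  rewrite /flipped_matrix /principal_matrix opp_col_mx; congr col_mx;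
    apply/matrixP => i i'; rewrite !mxE /flip !inE.
    by rewrite mulrNN !mul1r opprB.
  by rewrite mulN1r; case: (i == i').
have -> : foldl (fun M k => mutate k M) (- principal_matrix Q^T) ls =
    - mutated_matrix Q^T ls.
  rewrite /mutated_matrix; elim: ls {cE} (principal_matrix _) => //= k ls IHls M.
  by rewrite mutateN IHls.
by apply/colP => i; rewrite !mxE.
Qed.

End Symmetry.

(** * Coordinates of the vectors of arcs *)

Section Bounds.
Variables (n : nat) (o : 'I_n.+1 -> bool).
Hypothesis n_gt0 : (0 < n)%N.
Let N : int := n.+1%:Z.
Local Notation lab := (label o).
Let Q := cycle_quiver o.

Lemma edge_vectorE x v : edge_vector n x v 0 = coord N x v%:Z.
Proof. by rewrite mxE. Qed.

Lemma c_vector_edge c : (exists v, lab (v - 1) != lab v) -> c_vectors Q c ->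
  exists x, [/\ c = edge_vector n x, ~~ (N %| x.2 - x.1)%Z &
    lab x.1 = lab x.2 -> `|x.2 - x.1| < N].
Proof.
move=> lab_var [ks [j ->]].
have [e [e_seed [_ Ml]]] : exists e, noncrossing_seed N lab e /\
    realizes N lab (mutated_matrix Q ks) e.
  elim/last_ind: ks => [|ks k [e [e_seed Me]]].
    exists (path_edges id).
    by split; [exact: path_edges_id_seed | exact: realizes_principal].
  rewrite mutated_matrix_rcons.
  by apply: realizes_mutate; [| exact: label_periodic | exact: e_seed |].
have [_ nd cp] := e_seed.
exists (e j); split=> //; first by apply/colP => v; rewrite !mxE Ml.
apply: same_label_short => //; first exact: label_periodic.
by apply: cp; rewrite orbT.
Qed.

Lemma divz_ord (b : int) (v : 'I_n.+1) :
  ((b - v%:Z) %/ N)%Z = (b %/ N)%Z - ((b %% N)%Z < v%:Z)%R%:Z.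
Proof.
have r0 := modz_ge0 b (lt0r_neq0 (isT : 0 < N)); have rN := ltz_pmod b (isT : 0 < N).
have vN : v%:Z < N by rewrite ltz_nat.
rewrite {1}(divz_eq b N) -addrA divzMDl //; congr (_ + _).
move: (b %% N)%Z r0 rN vN => r r0 rN vN; have [rv|vr] := ltP r v%:Z.
  have -> : r - v%:Z = - 1 * N + (r - v%:Z + N) by clear; lia.
  by rewrite divzMDl // divz_small ?addr0 // gtz0_abs //; move: rv r0 vN; clear; lia.
by rewrite divz_small ?oppr0 // gtz0_abs //; move: vr rN; clear; lia.
Qed.

(** Up to a constant, the coordinate at [v] is the indicator of [r < v] minus that of [r' < v], for
    the residues [r], [r'] of the ends. Depending on the order of [r] and [r'], it takes values in
    {0, 1} or in {0, -1}. *)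
Lemma edge_vector_diff x (v w : 'I_n.+1) :
  `|edge_vector n x v 0 - edge_vector n x w 0| <= 1.
Proof.
rewrite !edge_vectorE /coord !divz_ord.
have := ltn_ord v; have := ltn_ord w; clear.
move: (x.1 %/ N)%Z (x.1 %% N)%Z (x.2 %/ N)%Z (x.2 %% N)%Z => q r q' r'.
by move: (nat_of_ord v) (nat_of_ord w) => v' w' _ _; lia.
Qed.

(** Each further turn around the cycle adds the null root. *)
Lemma edge_vector_shift a b l v :
  edge_vector n (a, b + l * N) v 0 = edge_vector n (a, b) v 0 + l.
Proof. by rewrite !edge_vectorE /coord /= addrAC divz_shift //; ring. Qed.

Lemma edge_vectorN a b : edge_vector n (b, a) = - edge_vector n (a, b).
Proof. by apply/colP => v; rewrite !mxE /coord /= opprB. Qed.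

Lemma edge_vector_step b (v : 'I_n.+1) :
  edge_vector n (b - 1, b) v 0 = (N %| b - v%:Z)%Z%:Z.
Proof. by rewrite edge_vectorE coord_simple. Qed.

Lemma edge_vectorD a b d :
  edge_vector n (a, d) = edge_vector n (a, b) + edge_vector n (b, d).
Proof. by apply/colP => v; rewrite !mxE /coord /=; ring. Qed.

Lemma cycle_quiver_opposite : cycle_quiver (negb \o o) = Q^T.
Proof.
apply/matrixP => i j; rewrite [RHS]mxE !cycle_quiverE /= negbK addnC.
by [].
Qed.

(** Arcs to the left are negatives of arcs to the right; an arc from the upper to the lower side
    goes from lower to upper for the opposite quiver, whose labels are negated. *)
Lemma mixed_edge_c_vector a b : acyclic_quiver Q -> lab a != lab b ->
  c_vectors Q (edge_vector n (a, b)).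
Proof.
move=> Qac.
have neg_label o' d : label (negb \o o') d = ~~ label o' d by [].
have change (a' b' : int) : lab a' != lab b' -> exists v, lab (v - 1) != lab v.
  move=> ab; apply: contrapT => nv.
  have const d : lab (d - 1) = lab d.
    by apply/eqP; apply: contrapT => /negP dd; apply: nv; exists d.
  have constN (k : nat) d : lab (d + k%:Z) = lab d.
    elim: k d => [|k IHk] d; first by rewrite addr0.
    by rewrite -(IHk d) -(const (d + k.+1%:Z)); congr lab; lia.
  case/negP: ab; apply/eqP; have [le|lt] := leP a' b'.
    by rewrite -(constN (absz (b' - a')%R) a'); congr lab; lia.
  by rewrite -(constN (absz (a' - b')%R) b'); congr lab; lia.
wlog ab : a b / a < b => [th lab_ab|lab_ab].
  case: (ltgtP a b) => [ab|ba|E]; first exact: th.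
    by rewrite edge_vectorN; apply/c_vectorsN/th; rewrite // eq_sym.
  by rewrite E eqxx in lab_ab.
case la: (lab a); last first.
  apply: positive_edge_c_vector => //; first exact: change lab_ab.
    by rewrite la.
  by move: lab_ab; rewrite la; case: (lab b).
apply: c_vectors_opposite => //; rewrite -cycle_quiver_opposite.
apply: positive_edge_c_vector => //.
- by have [v lv] := change _ _ lab_ab; exists v; rewrite !neg_label; move: lv;
    case: (lab _); case: (lab _).
- by rewrite neg_label la.
- by rewrite neg_label; move: lab_ab; rewrite la; case: (lab b).
Qed.

Lemma simple_c_vector (v : 'I_n.+1) : c_vectors Q (edge_vector n (v%:Z - 1, v%:Z)).
Proof.
exists [::], v; apply/colP => w; rewrite edge_vector_step dvdz_ord.
rewrite [RHS]mxE [RHS]mxE /mutated_matrix /= /principal_matrix col_mxEd mxE.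
by case: (w == v).
Qed.

End Bounds.

(** [supremum] chooses among the suprema; they are unique, and a largest element is one. *)
Lemma supremum_max (A : set int) (a : int) : A a -> (forall b, A b -> b <= a) ->
  supremum 0 A = a.
Proof.
move=> Aa Amax; have sa : supremums A a.
  by split=> [b /Amax //|b]; apply.
rewrite /supremum ifF; last by apply/negbTE/set0P; exists a.
case: xgetP => [b _ sb|/(_ a)//]; exact: is_subset1_supremums sb sa.
Qed.

(** * Source-sink orientations *)

Section SourceSink.
Variables (n : nat) (o : 'I_n.+1 -> bool) (s t : 'I_n.+1).
Hypotheses (n_gt0 : (0 < n)%N) (st_o : source_sink_orientation o s t).
Let N : int := n.+1%:Z.
Local Notation lab := (label o).
Let Q := cycle_quiver o.

Let Q_acyclic : acyclic_quiver Q. Proof. by case: st_o. Qed.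

Lemma label_ord_pred (v : 'I_n.+1) : lab (v%:Z - 1) = o (ord_pred v).
Proof. by rewrite -{1}(ord_predK v) label_pred. Qed.

Lemma is_sourceE (v : 'I_n.+1) : is_source Q v <-> ~~ lab (v%:Z - 1) && lab v%:Z.
Proof.
rewrite label_ord_pred label_ord.
rewrite /is_source /arrow; split=> [src|/andP[op ov] i].
  have := src (ord_pred v); have := src (ordS v).
  rewrite /Q !cycle_quiverE ord_predK !eqxx !andbT.
  by case: (o (ord_pred v)); case: (o v) => //=; rewrite addnC.
rewrite /Q cycle_quiverE ov /= addn0 lt0b; apply/negP => /andP[oi /eqP vE].
by move: op; rewrite vE ordSK oi.
Qed.

Lemma is_sinkE (v : 'I_n.+1) : is_sink Q v <-> lab (v%:Z - 1) && ~~ lab v%:Z.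
Proof.
rewrite label_ord_pred label_ord.
rewrite /is_sink /arrow; split=> [src|/andP[op ov] i].
  have := src (ord_pred v); have := src (ordS v).
  rewrite /Q !cycle_quiverE ord_predK !eqxx !andbT.
  by case: (o (ord_pred v)); case: (o v) => //=; rewrite addnC.
rewrite /Q cycle_quiverE (negbTE ov) /= lt0b; apply/negP => /andP[oi /eqP vE].
by move: op; rewrite vE ordSK (negbTE oi).
Qed.

(** The orientation changes exactly at the source and at the sink. *)
Lemma label_step (b : int) :
  (lab b)%:Z - (lab (b - 1))%:Z = (N %| b - s%:Z)%Z%:Z - (N %| b - t%:Z)%Z%:Z.
Proof.
have [v [l ->]] := reduce_mod n b.
have D a : (N %| v%:Z + l * N - a)%Z = (N %| v%:Z - a)%Z.
  by rewrite addrAC rpredDr // dvdz_mull.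
rewrite !D [_ - 1]addrAC !(periodicM _ _ (label_periodic o)) !dvdz_ord.
have [_ srcE snkE] := st_o.
have -> : (s == v) = ~~ lab (v%:Z - 1) && lab v%:Z.
  by apply/eqP/idP => [sv|/is_sourceE/srcE//]; apply/is_sourceE/srcE.
have -> : (t == v) = lab (v%:Z - 1) && ~~ lab v%:Z.
  by apply/eqP/idP => [sv|/is_sinkE/snkE//]; apply/is_sinkE/snkE.
by case: (lab _); case: (lab _).
Qed.

Lemma source_neq_sink : s != t.
Proof.
have [_ srcE snkE] := st_o; apply/eqP => stE.
have /is_sourceE/andP[_ +] : is_source Q s by apply/srcE.
by have /is_sinkE/andP[_ /negbTE ->] : is_sink Q s by apply/snkE.
Qed.

Lemma label_source : lab (s%:Z - 1) != lab s%:Z.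
Proof.
have [_ srcE _] := st_o.
by have /is_sourceE/andP[/negbTE -> ->] : is_source Q s by apply/srcE.
Qed.

Lemma label_sink : lab (t%:Z - 1) != lab t%:Z.
Proof.
have [_ _ snkE] := st_o.
by have /is_sinkE/andP[-> /negbTE ->] : is_sink Q t by apply/snkE.
Qed.

(** [label_step] telescopes over the unit steps from [a] to [b]. *)
Lemma edge_vector_source_sink a b :
  edge_vector n (a, b) s 0 - edge_vector n (a, b) t 0 = (lab b)%:Z - (lab a)%:Z.
Proof.
have up (k : nat) (a' : int) :
    edge_vector n (a', a' + k%:Z) s 0 - edge_vector n (a', a' + k%:Z) t 0 =
    (lab (a' + k%:Z))%:Z - (lab a')%:Z.
  elim: k => [|k IHk].
    by rewrite addr0 subrr !edge_vectorE /coord /= !subrr.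
  rewrite (edge_vectorD _ _ (a' + k%:Z)) !mxE -!edge_vectorE.
  have kE : a' + k.+1%:Z - 1 = a' + k%:Z by clear; lia.
  have := label_step (a' + k.+1%:Z).
  have := edge_vector_step (a' + k.+1%:Z) s.
  have := edge_vector_step (a' + k.+1%:Z) t.
  rewrite kE => -> ->; rewrite -!/N; move: IHk.
  by move=> E1 E2; rewrite opprD addrACA E1 -E2; ring.
have [le|lt] := leP a b.
  have := up (absz (b - a)%R) a.
  by have -> : a + (absz (b - a)%R)%:Z = b by move: le; clear; lia.
have := up (absz (a - b)%R) b.
have -> : b + (absz (a - b)%R)%:Z = a by move: lt; clear; lia.
rewrite edge_vectorN !mxE -!edge_vectorE; clear; lia.
Qed.

Lemma short_edge_vector a b (v : 'I_n.+1) : `|b - a| < N ->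
  `|edge_vector n (a, b) v 0| <= 1.
Proof.
rewrite edge_vectorE /coord /=; have N0 : 0 < N by [].
have := divz_eq (b - v%:Z) N; have := ltz_pmod (b - v%:Z) N0.
have := modz_ge0 (b - v%:Z) (lt0r_neq0 N0).
have := divz_eq (a - v%:Z) N; have := ltz_pmod (a - v%:Z) N0.
have := modz_ge0 (a - v%:Z) (lt0r_neq0 N0).
move: (_ %/ _)%Z (_ %% _)%Z => q r r0 rN E.
move: (_ %/ _)%Z (_ %% _)%Z => q' r' r0' rN' E' ab.
have : q' * N < (q + 2) * N by rewrite mulrDl; move: E E' r0 rN r0' rN' ab; clear; lia.
have : q * N < (q' + 2) * N by rewrite mulrDl; move: E E' r0 rN r0' rN' ab; clear; lia.
by rewrite !ltr_pM2r //; clear; lia.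
Qed.

(** The coefficient of [c j] is 1 minus the number of arrows into [j]: 1 at the source, -1 at the
    sink, 0 elsewhere. *)
Lemma defectE c : defect Q c = c s 0 - c t 0.
Proof.
rewrite /defect /euler_form exchange_big /= -sumrB.
have nE i : null_root n.+1 i 0 = 1 by rewrite mxE.
under eq_bigr => j _.
  rewrite nE mul1r.
  under eq_bigr do rewrite nE mul1r.
  rewrite -mulr_suml -{1}[c j 0]mul1r -mulrBl.
  have -> : 1 - \sum_i (Q i j)%:Z = (j == s)%:Z - (j == t)%:Z.
    rewrite -(big_morph _ PoszD (erefl 0%:Z)) /Q.
    under eq_bigr do rewrite cycle_quiverE.
    rewrite big_split /= (bigD1 (ord_pred j)) //= ord_predK eqxx andbT.
    rewrite [X in (_ + X + _)%N]big1 ?addn0; last first.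
      move=> i ij; case: eqP => [jE|]; last by rewrite andbF.
      by rewrite jE ordSK eqxx in ij.
    rewrite (bigD1 (ordS j)) //= eqxx andbT big1 ?addn0; last first.
      by move=> i /negbTE ->; rewrite andbF.
    have := label_step j%:Z.
    rewrite !dvdz_ord label_ord_pred label_ord.
    rewrite [j == s]eq_sym [j == t]eq_sym => <-.
    by case: (o _); case: (o _).
  over.
rewrite /=; under eq_bigr do rewrite mulrBl.
rewrite sumrB; congr (_ - _).
  rewrite (bigD1 s) //= eqxx mul1r big1 ?addr0 // => i /negbTE ->.
  by rewrite mul0r.
rewrite (bigD1 t) //= eqxx mul1r big1 ?addr0 // => i /negbTE ->.
by rewrite mul0r.
Qed.

Lemma label_varies : exists v, lab (v - 1) != lab v.
Proof. by exists s%:Z; exact: label_source. Qed.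

Lemma mixed_edge_with_diff (v w : 'I_n.+1) (d : int) : v != w -> `|d| <= 1 ->
  (d = 0 -> ~ same_pair v w s t) ->
  exists a b, lab a != lab b /\
    edge_vector n (a, b) v 0 - edge_vector n (a, b) w 0 = d.
Proof.
move=> vw d1 d0.
pose diff a b := edge_vector n (a, b) v 0 - edge_vector n (a, b) w 0.
have diffD a b c : diff a c = diff a b + diff b c.
  by rewrite /diff (edge_vectorD n a b c) !mxE -!edge_vectorE; ring.
have diffN a b : diff b a = - diff a b.
  by rewrite /diff edge_vectorN !mxE -!edge_vectorE; ring.
have diff1 a b : `|diff a b| <= 1 by exact: edge_vector_diff.
have step b : diff (b - 1) b = (N %| b - v%:Z)%Z%:Z - (N %| b - w%:Z)%Z%:Z.
  by rewrite /diff !edge_vector_step.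
have one : exists a b, lab a != lab b /\ diff a b = 1.
  have v1 : diff (v%:Z - 1) v%:Z = 1.
    by rewrite step subrr dvdz0 dvdz_ord eq_sym (negbTE vw).
  (* If the arc of the simple root at [v] stays on one side, it is cut at a point [c] of the other
     side: the differences of the two pieces are at most 1 and add up to 1, so one of them is 1. *)
  have [lv|lv] := eqVneq (lab (v%:Z - 1)) (lab v%:Z); last first.
    by exists (v%:Z - 1), v%:Z.
  have [c lc] : exists c, lab c != lab v%:Z.
    have [c lc] := label_varies; have [E|] := eqVneq (lab c) (lab v%:Z).
      by exists (c - 1); rewrite -E.
    by exists c.
  have := diffD (v%:Z - 1) c v%:Z; rewrite v1 => E.
  have [dc|dc] := eqVneq (diff c v%:Z) 1; first by exists c, v%:Z.
  exists (v%:Z - 1), c; rewrite lv eq_sym lc; split=> //.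
  have := diff1 c v%:Z; have := diff1 (v%:Z - 1) c.
  by move: (diff c v%:Z) (diff (v%:Z - 1) c) E dc => e1 e2; clear; lia.
have zero : ~ same_pair v w s t -> exists a b, lab a != lab b /\ diff a b = 0.
  (* The witness is the simple root at one of [s] and [t] outside the pair; its arc joins the two
     sides. *)
  move=> nsp; have other (r : 'I_n.+1) : v != r -> w != r -> diff (r%:Z - 1) r%:Z = 0.
    by move=> vr wr; rewrite step !dvdz_ord (negbTE vr) (negbTE wr).
  have st := source_neq_sink.
  have [vs|vs] := eqVneq v s.
    exists (t%:Z - 1), t%:Z; split; first exact: label_sink.
    apply: other; first by rewrite vs.
    by apply: contra_notN nsp => /eqP wt; left.
  have [ws|ws] := eqVneq w s.
    exists (t%:Z - 1), t%:Z; split; first exact: label_sink.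
    apply: other; last by rewrite ws.
    by apply: contra_notN nsp => /eqP vt; right.
  exists (s%:Z - 1), s%:Z; split; [exact: label_source | exact: other].
have [d_eq0|[->|->]] : d = 0 \/ (d = 1 \/ d = -1) by move: d1; clear; lia.
- by rewrite d_eq0; apply: zero; exact: d0.
- exact: one.
- have [a [b [ab E]]] := one; exists b, a; rewrite eq_sym; split=> //.
  by rewrite -/(diff _ _) diffN E.
Qed.

Lemma line_sub_projection (v w : 'I_n.+1) (d : int) : v != w -> `|d| <= 1 ->
  (d = 0 -> ~ same_pair v w s t) -> line d `<=` coord_proj v w @` c_vectors Q.
Proof.
move=> vw d1 d0 [a' b'] /= abd.
have [a [b [lab_ab E]]] := mixed_edge_with_diff vw d1 d0.
(* Turns around the cycle move the vector along the line, and the ends of the arc keep their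
   labels. *)
exists (edge_vector n (a, b + (a' - edge_vector n (a, b) v 0) * N)).
  apply: mixed_edge_c_vector => //.
  by rewrite (periodicM _ _ (label_periodic o)).
rewrite /coord_proj !edge_vector_shift.
have {}abd : a' - b' = d by [].
move: (edge_vector _ _ v 0) (edge_vector _ _ w 0) E => e1 e2 E.
by congr (_, _); move: E abd; clear; lia.
Qed.

Lemma c_vector_diff c (v w : 'I_n.+1) : c_vectors Q c -> `|c v 0 - c w 0| <= 1.
Proof.
move=> /(c_vector_edge n_gt0 label_varies)[x [-> _ _]].
exact: edge_vector_diff.
Qed.

Lemma diagonal_c_vector c : c_vectors Q c -> c s 0 = c t 0 -> `|c s 0| <= 1.
Proof.
move=> /(c_vector_edge n_gt0 label_varies)[[a b] [-> _ short]] cst.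
apply: short_edge_vector; apply: short => /=.
have := edge_vector_source_sink a b; rewrite cst subrr.
by case: (lab a); case: (lab b).
Qed.

(** For [n = 1] the labels alternate, so an arc with both ends on one side has even length and would
    be closed. *)
Lemma off_diagonal_kronecker c : n = 1%N -> c_vectors Q c -> c s 0 <> c t 0.
Proof.
move=> n1 /(c_vector_edge n_gt0 label_varies)[[a b] [-> /= nd _]] cst.
have flip (d : int) : lab (d - 1) != lab d.
  have [v [l ->]] := reduce_mod n d.
  rewrite addrAC !(periodicM _ _ (label_periodic o)).
  have [->|->] : v = s \/ v = t; [|exact: label_source | exact: label_sink].
  have := source_neq_sink; rewrite -val_eqE /= => st.
  have [vs|vs] := eqVneq v s; [by left | right; apply/val_inj => /=].
  have lt2 (r : 'I_n.+1) : (r < 2)%N.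
    by have := ltn_ord r; move: (nat_of_ord r) => r'; rewrite n1.
  move: vs; rewrite -val_eqE /=; move: (lt2 v) (lt2 s) (lt2 t) st.
  by clear; lia.
have bE : b = a + 1 + ((b - a) %/ N)%Z * N.
  have := divz_eq (b - a) N; have := ltz_pmod (b - a) (isT : 0 < N).
  have := modz_ge0 (b - a) (lt0r_neq0 (isT : 0 < N)).
  have : ((b - a) %% N)%Z != 0 by apply: contra nd => /eqP/dvdz_mod0P.
  have -> : N = 2 by rewrite /N n1.
  by move: (_ %% _)%Z (_ %/ _)%Z => r q; clear; lia.
have := edge_vector_source_sink a b; rewrite cst subrr.
have : lab b = lab (a + 1) by rewrite bE (periodicM _ _ (label_periodic o)).
have := flip (a + 1); rewrite addrK => + ->.
by case: (lab a); case: (lab (a + 1)).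
Qed.

(** For [n = 1] the interval is empty, encoded by the bounds 1 and 0. Otherwise it contains 0, is
    symmetric and lies within [-1, 1], so whether 1 occurs decides it. *)
Lemma diagonal_interval : exists a b : int, ((1 < n)%N -> a <= b) /\
  forall x : int, (exists2 c, c_vectors Q c & c s 0 = x /\ c t 0 = x) <-> a <= x <= b.
Proof.
pose D (x : int) := exists2 c, c_vectors Q c & c s 0 = x /\ c t 0 = x.
have DN (x : int) : D x -> D (- x).
  by case=> c cQ [cs ct]; exists (- c); [exact: c_vectorsN | rewrite !mxE cs ct].
have D1 (x : int) : D x -> `|x| <= 1.
  by case=> c cQ [<- ct]; apply: diagonal_c_vector => //; rewrite ct.
have [n1|n1] := leqP n 1.
  exists 1, 0; split=> // x; split; last by clear; lia.
  case=> c cQ [cs ct]; exfalso; apply: (@off_diagonal_kronecker c) => //.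
    by apply/eqP; rewrite eqn_leq n1.
  by rewrite cs ct.
have D0 : D 0.
  (* The simple root at a third vertex has both coordinates 0. *)
  have [v] : exists v, v \in ~: [set s; t]%SET.
    apply/set0Pn; rewrite -card_gt0 cardsCs finset.setCK card_ord cards2.
    by move: n1; case: (_ != _); clear; lia.
  rewrite !inE negb_or => /andP[vs vt].
  exists (edge_vector n (v%:Z - 1, v%:Z)); first exact: simple_c_vector.
  rewrite !edge_vector_step !dvdz_ord.
  by rewrite [s == v]eq_sym [t == v]eq_sym (negbTE vs) (negbTE vt).
have [d1|d1] := pselect (D 1).
  exists (-1), 1; split=> // x; split=> [/D1|]; first by clear; lia.
  move=> x1; have [->|[->|->]] : x = 0 \/ (x = 1 \/ x = -1) by move: x1; clear; lia.
  - exact: D0.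
  - exact: d1.
  - exact: DN.
exists 0, 0; split=> // x; split=> [Dx|x0]; last first.
  by have -> : x = 0 by move: x0; clear; lia.
have [->//|[x1|x1]] : x = 0 \/ (x = 1 \/ x = -1) by move: (D1 x Dx); clear; lia.
  by case: d1; rewrite -x1.
by case: d1; rewrite -[1]opprK -x1; exact: DN.
Qed.

End SourceSink.

Theorem theorem1p2 (n : nat) (hn : (0 < n)%N) (o : 'I_n.+1 -> bool)
    (s t : 'I_n.+1) (hQ : source_sink_orientation o s t) :
  let Q := cycle_quiver o in
  [/\ (forall c, c_vectors Q c -> forall v w, `|c v 0 - c w 0| <= 1) /\
      (forall v w, v <> w -> band Q v w = unit_band),
      forall v w, v <> w -> ~ same_pair v w s t ->
        coord_proj v w @` c_vectors Q = unit_band,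
      (exists a b : int, ((1 < n)%N -> a <= b) /\
         coord_proj s t @` c_vectors Q =
           (unit_band `\` line 0) `|`
           (line 0 `&` [set xy : int * int | a <= xy.1 <= b])) /\
      c_vectors Q `&` [set c : 'cV[int]_n.+1 | c s 0 = c t 0] = regular_part Q
    & forall v w d, v <> w -> is_band_line Q v w d ->
        (~ filled Q v w d <-> same_pair v w s t /\ d = 0)].
Proof.
move=> Q; have diff c v w : c_vectors Q c -> `|c v 0 - c w 0| <= 1.
  exact: c_vector_diff hQ c v w.
have width v w : v <> w -> band_width Q v w = 1.
  move=> /eqP vw; apply: supremum_max => [|_ [c cQ <-]]; last exact: diff.
  have d1 : `|1 : int| <= 1 by rewrite normr1.
  have sub := line_sub_projection hn hQ vw d1 (fun h => ltac:(by [])).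
  (* The point (1, 0) of the projection attains the bound. *)
  have [|c cQ [cv cw]] := sub (1, 0); first by rewrite /line /= subr0.
  by exists c => //; rewrite cv cw subr0.
have sub_line v w d : v <> w -> `|d| <= 1 -> (d = 0 -> ~ same_pair v w s t) ->
    line d `<=` coord_proj v w @` c_vectors Q.
  by move=> /eqP; exact: line_sub_projection.
have st : s <> t by apply/eqP; exact: source_neq_sink hQ.
have [a [b [ab diag]]] := diagonal_interval hn hQ.
split.
- split=> [c cQ v w|v w vw]; first exact: diff.
  by rewrite /band width.
- move=> v w vw nsp; apply/seteqP; split=> [_ [c cQ <-]|[x y] xy]; first exact: diff.
  by apply: (sub_line v w (x - y)).
- split.
    exists a, b; split=> //; apply/seteqP; split=> [_ [c cQ <-]|[x y]].
      have [E|E] := eqVneq (c s 0) (c t 0); [right | left].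
        split; first by rewrite /line /coord_proj /= E subrr.
        by apply/diag; exists c; rewrite ?E.
      split; first exact: diff.
      by rewrite /line /coord_proj /= => /eqP; rewrite subr_eq0 (negbTE E).
    case=> [[xy nxy]|[xy /diag[c cQ [cs ct]]]].
      by apply: (sub_line s t (x - y)).
    exists c; rewrite // /coord_proj cs ct; congr (_, _).
    by apply/eqP; rewrite -subr_eq0; apply/eqP.
  apply/seteqP; split=> c [cQ E]; split=> //.
    by rewrite (defectE hQ) E subrr.
  by move: E; rewrite (defectE hQ) => /eqP; rewrite subr_eq0 => /eqP.
move=> v w d vw; rewrite /is_band_line width // => d1; split=> [nf|[sp ->] f].
  split; last first.
    by apply: contrapT => d0; apply: nf; apply: sub_line.
  by apply: contrapT => nsp; apply: nf; apply: sub_line.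
(* Diagonal values are at most 1 in absolute value, so the point (2, 2) is missed. *)
have far : forall c, c_vectors Q c -> c s 0 = c t 0 -> c s 0 <> 2.
  by move=> c cQ /(diagonal_c_vector hn hQ cQ) + cs; rewrite cs.
have [c cQ [cv cw]] := f (2, 2) (subrr _).
by case: sp => -[vE wE]; apply: (far c cQ); rewrite -?vE -?wE ?cv ?cw.
Qed.
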